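(* Let $(M,\mathcal F,g_\intercal)$ be a simple Lorentzian foliation, with associated spacetime $(B,h)$ and onto submersion $\pi:M\to B$. If $\pi$ is proper and there is a $C^0$ neighborhood $\mathcal U$ of $g_\intercal$ in $\mathcal{TL}(M,\mathcal F)$ such that $(M,\mathcal F,g'_\intercal)$ is transversely causal for all $g'_\intercal\in\mathcal U$, then $(M,\mathcal F,g_\intercal)$ is transversely stably causal.
   Context: $M$ is a connected smooth manifold of dimension $n\ge 3$. $\mathcal F$ is a regular foliation of codimension $q\geq 2$: a partition of $M$ into connected immersed submanifolds (leaves), locally given by the fibers of a submersion. $T\mathcal F\subset TM$ is the (vertical) distribution tangent to the leaves; vectors in $T\mathcal F$, and vector fields with values in it, are called vertical. A transverse Lorentzian metric on $(M,\mathcal F)$ is a smooth symmetric $(0,2)$-tensor field $g_\intercal$ on $M$ with $\mathcal L_Vg_\intercal=0$ for all vertical $V$, such that at each $x$ the bilinear form $g_\intercal(x)$ has index $1$ and its kernel is exactly $T_x\mathcal F$. $\mathcal{TL}(M,\mathcal F)$ is the set of these. The $C^0$ topology on $\mathcal{TL}(M,\mathcal F)$ is the one induced by the strong Whitney $C^0$ topology on smooth sections of the bundle of symmetric $(0,2)$-tensors on $M$. The triple $(M,\mathcal F,g_\intercal)$ is called a Lorentzian foliation. A nonvertical vector $v$ is transversely causal if $g_\intercal(v,v)\le 0$. The set of transversely causal vectors at $x$ has two connected components (causal wedges); a transverse time orientation is a continuous choice of one of them (the future causal wedge) at each point; vectors in it are future-directed. A future-directed transversely causal curve is a piecewise smooth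 curve whose tangent vectors lie in the future causal wedges. For leaves $L,L'$, write $L<_{M/\mathcal F}L'$ if there is a future-directed transversely causal curve from a point of $L$ to a point of $L'$. $(M,\mathcal F,g_\intercal)$ is transversely causal if $L\nless_{M/\mathcal F}L$ for every leaf $L$. For $g_\intercal,g'_\intercal\in\mathcal{TL}(M,\mathcal F)$, write $g_\intercal<g'_\intercal$ if for every $v\in TM\setminus T\mathcal F$, $g_\intercal(v,v)\le0\Rightarrow g'_\intercal(v,v)<0$; in that case $g'_\intercal$ is time-oriented so that its future wedges contain those of $g_\intercal$. $(M,\mathcal F,g_\intercal)$ is transversely stably causal if there is $g'_\intercal\in\mathcal{TL}(M,\mathcal F)$ with $g_\intercal<g'_\intercal$ and $(M,\mathcal F,g'_\intercal)$ transversely causal. Simple: $(M,\mathcal F,g_\intercal)$ is simple if there exist a spacetime (connected time-oriented Lorentzian manifold) $(B,h)$ and an onto submersion $\pi:M\to B$ (these are the ''associated'' ones) such that: the leaves of $\mathcal F$ are the connected components of the fibers of $\pi$; $g_\intercal=\pi^*h$ and the transverse time orientation is induced by that of $(B,h)$ (a transversely causal vector is future-directed iff its image under $d\pi$ is); and for all $b\in B$ there is an open neighborhood $\mathcal U\ni b$ such that every fiber of $\pi$ contained in $\pi^{-1}(\mathcal U)\setminus\pi^{-1}(b)$ is connected. *)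

(* Defs.v *)
From mathcomp Require Import all_boot all_order all_algebra.
From mathcomp Require Import all_classical all_reals all_analysis.

Set Implicit Arguments.
Unset Strict Implicit.
Unset Printing Implicit Defensive.

Import Order.TTheory GRing.Theory Num.Theory.
Import numFieldNormedType.Exports.

Local Open Scope classical_set_scope.
Local Open Scope ring_scope.

Section Smooth.
Variables (R : realType) (V W : normedModType R).

(* Only used on open sets of finite-dimensional spaces, where it is equivalent
   to the existence and continuity of all partial derivatives up to order k. *)
Fixpoint Ck_on (k : nat) (U : set V) (f : V -> W) : Prop :=
  (forall x, U x -> {for x, continuous f}) /\
  (if k is k'.+1 then
     forall v, (forall x, U x -> derivable f x v) /\
               Ck_on k' U (fun x => 'D_v f x)
   else True).

Definition smooth_on (U : set V) (f : V -> W) : Prop := forall k, Ck_on k U f.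

End Smooth.

Section Charts.
Variable R : realType.

(* The values of [fwd] outside [dom] and of [bwd] outside [cod] are junk. *)
Record chart (M : topologicalType) (n : nat) := Chart {
  dom : set M;
  cod : set 'rV[R]_n;
  fwd :> M -> 'rV[R]_n;
  bwd : 'rV[R]_n -> M;
  dom_open : open dom;
  cod_open : open cod;
  fwd_cod : forall x, dom x -> cod (fwd x);
  bwd_dom : forall p, cod p -> dom (bwd p);
  fwdK : forall x, dom x -> bwd (fwd x) = x;
  bwdK : forall p, cod p -> fwd (bwd p) = p;
  fwd_continuous : forall x, dom x -> {for x, continuous fwd};
  bwd_continuous : forall p, cod p -> {for p, continuous bwd} }.

Definition compatible (M : topologicalType) (n : nat) (c c' : chart M n) :=
  smooth_on (cod c `&` bwd c @^-1` dom c') (c' \o bwd c) /\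
  smooth_on (cod c' `&` bwd c' @^-1` dom c) (c \o bwd c').

(* The tangent space at [x] is encoded as 'rV[R]_n: a tangent vector is given
   by its components in the preferred chart [chart_at x]. *)
Record manifold (n : nat) := Manifold {
  carrier :> topologicalType;
  atlas : set (chart carrier n);
  chart_at : carrier -> chart carrier n;
  carrier_hausdorff : hausdorff_space carrier;
  carrier_second_countable : @second_countable carrier;
  chart_at_atlas : forall x, atlas (chart_at x);
  chart_at_dom : forall x, dom (chart_at x) x;
  atlas_compatible : forall c c', atlas c -> atlas c' -> compatible c c';
  atlas_maximal :
    forall c, (forall c', atlas c' -> compatible c c') -> atlas c }.

Definition connected_manifold (n : nat) (M : manifold n) : Prop :=
  [set: M] !=set0 /\ connected [set: M].

End Charts.

Section TangentSpaces.
Variables (R : realType) (n : nat) (M : manifold R n).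
Implicit Types (c : chart R M n) (x : M).

(* Tangent vectors are row vectors: [v *m to_chart c x] is the vector of
   components in the chart [c] of the tangent vector [v] at [x]. *)
Definition to_chart c x : 'M[R]_n := 'J (c \o bwd (chart_at x)) (chart_at x x).

(* Conversely, row [i] is the i-th coordinate vector field of [c] at [x]. *)
Definition of_chart c x : 'M[R]_n := 'J (chart_at x \o bwd c) (c x).

Definition vf_in (c : chart R M n) (X : M -> 'rV[R]_n) (p : 'rV[R]_n)
    : 'rV[R]_n :=
  X (bwd c p) *m to_chart c (bwd c p).

(* A (0,2)-tensor field [g] is given by its Gram matrices in the preferred
   charts; [tensor_in c g] is its Gram matrix in the chart [c]. *)
Definition tensor_in (c : chart R M n) (g : M -> 'M[R]_n) (p : 'rV[R]_n)
    : 'M[R]_n :=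
  of_chart c (bwd c p) *m g (bwd c p) *m (of_chart c (bwd c p))^T.

Definition smooth_vf (X : M -> 'rV[R]_n) : Prop :=
  forall c, atlas c -> smooth_on (cod c) (vf_in c X).

Definition smooth_tensor (g : M -> 'M[R]_n) : Prop :=
  forall c, atlas c -> smooth_on (cod c) (tensor_in c g).

Definition continuous_vf_on (U : set M) (X : M -> 'rV[R]_n) : Prop :=
  forall c, atlas c -> forall y, U y -> dom c y ->
    {for y, continuous (fun z => X z *m to_chart c z)}.

(* (L_X g)_ij = X^k d_k g_ij + (d_i X^k) g_kj + g_ik (d_j X^k), with
   ('J X p) i k = d_i X^k. *)
Definition lie_derivative_in (c : chart R M n) (X : M -> 'rV[R]_n)
    (g : M -> 'M[R]_n) (p : 'rV[R]_n) : 'M[R]_n :=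
  let Xc := vf_in c X in let gc := tensor_in c g in
  'D_(Xc p) gc p + 'J Xc p *m gc p + gc p *m ('J Xc p)^T.

Definition smooth_curve_on (J : set R) (gamma : R -> M) : Prop :=
  (forall t, J t -> {for t, continuous gamma}) /\
  forall c, atlas c -> smooth_on (J `&` gamma @^-1` dom c) (c \o gamma).

Definition velocity (gamma : R -> M) (t : R) : 'rV[R]_n :=
  derive1 (chart_at (gamma t) \o gamma) t.

Definition submersion_on (q : nat) (U : set M) (f : M -> 'rV[R]_q) : Prop :=
  (forall c, atlas c -> smooth_on (cod c `&` bwd c @^-1` U) (f \o bwd c)) /\
  forall x, U x -> row_full ('J (f \o bwd (chart_at x)) (chart_at x x)).

End TangentSpaces.

Section SmoothMaps.
Variables (R : realType) (n m : nat) (M : manifold R n) (N : manifold R m).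

Definition smooth_map (f : M -> N) : Prop :=
  continuous f /\
  forall c c', atlas c -> atlas c' ->
    smooth_on (cod c `&` (f \o bwd c) @^-1` dom c') (c' \o f \o bwd c).

(* The differential of [f] at [x] is [v |-> v *m tangent_map f x]. *)
Definition tangent_map (f : M -> N) (x : M) : 'M[R]_(n, m) :=
  'J (chart_at (f x) \o f \o bwd (chart_at x)) (chart_at x x).

Definition immersion (f : M -> N) : Prop :=
  smooth_map f /\ forall x, row_free (tangent_map f x).

Definition submersion (f : M -> N) : Prop :=
  smooth_map f /\ forall x, row_full (tangent_map f x).

Definition proper_map (f : M -> N) : Prop :=
  forall K : set N, compact K -> compact (f @^-1` K).

Definition pullback (f : M -> N) (h : N -> 'M[R]_m) (x : M) : 'M[R]_n :=
  tangent_map f x *m h (f x) *m (tangent_map f x)^T.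

End SmoothMaps.

Section Foliations.
Variables (R : realType) (n : nat) (M : manifold R n).

(* Near every point, each leaf is a countable union of fibers of one local
   submersion (countability is forced for immersed submanifolds, which are
   second countable). *)
Record foliation (q : nat) := Foliation {
  leaf_space : Type;
  leaf_manifold : leaf_space -> manifold R (n - q)%N;
  leaf_inc : forall L, leaf_manifold L -> M;
  codim_le : (q <= n)%N;
  leaf_connected : forall L, connected_manifold (leaf_manifold L);
  leaf_immersion : forall L, immersion (@leaf_inc L);
  leaf_injective : forall L, injective (@leaf_inc L);
  leaves_cover : forall x, exists L, range (@leaf_inc L) x;
  leaves_disjoint : forall L L' x,
    range (@leaf_inc L) x -> range (@leaf_inc L') x -> L = L';
  leaves_local : forall x, exists (U : set M) (f : M -> 'rV[R]_q),
    [/\ open U, U x, submersion_on U f &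
      forall L, exists2 C : set 'rV[R]_q, countable C &
        U `&` range (@leaf_inc L) = U `&` f @^-1` C] }.

Definition leaf (q : nat) (F : foliation q) (L : leaf_space F) : set M :=
  range (@leaf_inc q F L).

Definition vertical (q : nat) (F : foliation q) (x : M) : set 'rV[R]_n :=
  [set v | exists (L : leaf_space F) (y : leaf_manifold L) (w : 'rV[R]_(n - q)),
     leaf_inc y = x /\ v = w *m tangent_map (@leaf_inc q F L) y].

End Foliations.

Section BilinearForms.
Variables (R : realType) (n : nat).
Implicit Types G : 'M[R]_n.

Definition bilin G (v w : 'rV[R]_n) : R := (v *m G *m w^T) 0 0.

Definition kernel G : set 'rV[R]_n := [set v | forall w, bilin G v w = 0].

(* Subspaces of R^n are row spaces of square matrices. *)
Definition negative_definite_on G (W : 'M[R]_n) : Prop :=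
  forall v : 'rV[R]_n, (v <= W)%MS -> v != 0 -> bilin G v v < 0.

Definition has_index G (k : nat) : Prop :=
  (exists2 W : 'M[R]_n, negative_definite_on G W & \rank W = k) /\
  forall W : 'M[R]_n, negative_definite_on G W -> (\rank W <= k)%N.

Definition causal_vectors (vert : set 'rV[R]_n) G : set 'rV[R]_n :=
  [set v | ~ vert v /\ bilin G v v <= 0].

End BilinearForms.

Section TimeOrientations.
Variables (R : realType) (n : nat) (M : manifold R n).

(* [vert] is the degeneracy distribution of [g]: the vertical distribution of
   a foliation, or {0} for a Lorentzian metric. *)
Definition time_orientation (vert : M -> set 'rV[R]_n) (g : M -> 'M[R]_n)
    (tau : M -> set 'rV[R]_n) : Prop :=
  (forall x, exists2 v, causal_vectors (vert x) (g x) v &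
     tau x = connected_component (causal_vectors (vert x) (g x)) v) /\
  (forall x, exists (U : set M) (X : M -> 'rV[R]_n),
     [/\ open U, U x, continuous_vf_on U X & forall y, U y -> tau y (X y)]).

(* The curve is [gamma] restricted to [a, b]. Each smooth piece extends
   smoothly to an open neighborhood of its closed parameter interval, so that
   the one-sided velocities at the break points are constrained as well. *)
Definition future_curve (tau : M -> set 'rV[R]_n) (gamma : R -> M) (a b : R)
    : Prop :=
  a < b /\
  exists (k : nat) (t : nat -> R),
    [/\ t 0%N = a, t k = b &
      forall i, (i < k)%N -> t i < t i.+1 /\
        exists (J : set R) (eta : R -> M),
          [/\ open J, `[t i, t i.+1] `<=` J, smooth_curve_on J eta &
            forall s, s \in `[t i, t i.+1] ->
              eta s = gamma s /\ tau (eta s) (velocity eta s)]].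

End TimeOrientations.

Record spacetime (R : realType) (m : nat) := Spacetime {
  st_manifold :> manifold R m;
  st_metric : st_manifold -> 'M[R]_m;
  st_future : st_manifold -> set 'rV[R]_m;
  st_connected : connected_manifold st_manifold;
  st_smooth : smooth_tensor st_metric;
  st_symmetric : forall b, (st_metric b)^T = st_metric b;
  st_nondegenerate : forall b, kernel (st_metric b) = [set 0];
  st_index : forall b, has_index (st_metric b) 1;
  st_time_oriented : time_orientation (fun=> [set 0]) st_metric st_future }.

Section LorentzianFoliations.
Variables (R : realType) (n q : nat) (M : manifold R n) (F : foliation M q).
Implicit Types (g : M -> 'M[R]_n) (tau : M -> set 'rV[R]_n).

Definition transverse_lorentzian : set (M -> 'M[R]_n) := [set g |
  [/\ smooth_tensor g,
      forall x, (g x)^T = g x,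
      forall X : M -> 'rV[R]_n, smooth_vf X ->
        (forall x, vertical F x (X x)) ->
        forall c, atlas c -> forall p, cod c p -> lie_derivative_in c X g p = 0 &
      forall x, has_index (g x) 1 /\ kernel (g x) = vertical F x]].

Definition transverse_time_orientation g tau : Prop :=
  time_orientation (vertical F) g tau.

(* Basic neighborhoods of [g] in the strong Whitney C^0 topology: locally
   finite families of charts [c i], compact sets [K i] in their domains, and
   tolerances [e i]. *)
Definition whitney_C0_nbhd g (A : set (M -> 'M[R]_n)) : Prop :=
  exists (I : Type) (c : I -> chart R M n) (K : I -> set M) (e : I -> R),
    [/\ forall i, [/\ atlas (c i), compact (K i), K i `<=` dom (c i) & 0 < e i],
        forall x, exists U : set M, [/\ open U, U x &
          finite_set [set i | U `&` dom (c i) !=set0]] &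
        [set g' | smooth_tensor g' /\ (forall x, (g' x)^T = g' x) /\
           forall i x, K i x ->
             `|tensor_in (c i) g' (c i x) - tensor_in (c i) g (c i x)| < e i]
        `<=` A].

Definition TL_C0_nbhd g (U : set (M -> 'M[R]_n)) : Prop :=
  exists2 A, whitney_C0_nbhd g A & U = A `&` transverse_lorentzian.

Definition leaf_precedes tau (L L' : leaf_space F) : Prop :=
  exists (gamma : R -> M) (a b : R),
    [/\ future_curve tau gamma a b, leaf L (gamma a) & leaf L' (gamma b)].

(* [tau] is the future wedge field of the Lorentzian foliation; the metric
   enters only through it. *)
Definition transversely_causal tau : Prop := forall L, ~ leaf_precedes tau L L.

Definition wider g g' : Prop :=
  forall x v, ~ vertical F x v ->
    bilin (g x) v v <= 0 -> bilin (g' x) v v < 0.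

Definition transversely_stably_causal g tau : Prop :=
  exists g' tau',
    [/\ transverse_lorentzian g', wider g g',
        transverse_time_orientation g' tau',
        (forall x, tau x `<=` tau' x) & transversely_causal tau'].

(* [pi] exhibits (M, F, g, tau) as a simple Lorentzian foliation with
   associated spacetime [B]. *)
Definition simple_over (m : nat) (B : spacetime R m) (pi : M -> B) g tau
    : Prop :=
  [/\ submersion pi /\ range pi = [set: B],
      range (@leaf R n M q F) =
        range (fun x => connected_component (pi @^-1` [set pi x]) x),
      g = pullback pi (@st_metric R m B),
      forall x v, causal_vectors (vertical F x) (g x) v ->
        (tau x v <-> st_future (pi x) (v *m tangent_map pi x)) &
      forall b : B, exists U : set B, [/\ open U, U b &
        forall b', pi @^-1` [set b'] `<=` pi @^-1` U `\` pi @^-1` [set b] ->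
          connected (pi @^-1` [set b'])]].

End LorentzianFoliations.

(* Main.v *)
From HB Require Import structures.
Require Import Defs.
From mathcomp Require Import all_boot all_order all_algebra.
From mathcomp Require Import all_classical all_reals all_analysis.
From mathcomp Require Import ring lra zify.

(* Let w be a smooth covector field on B that does not vanish on any nonzero
   causal vector. Then h - w (x) w is again Lorentzian, with wider cones: it
   agrees with h on ker w, where h is positive, and it is negative on every
   causal vector of h. Its pullback is g - s (x) s with s = pi^* w, a transverse
   Lorentzian metric because s is basic, and it lies in the given neighborhood
   of g as soon as s is small in the Whitney topology.

   To make s small, w is built as a locally finite sum of eps_k a_k with each
   a_k compactly supported. As pi is proper, the support of pi^* a_k meets only
   finitely many of the charts that define the neighborhood, so that eps_k > 0
   can be chosen small enough. Near a point b_k, a_k is a bump function times a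
   covector with constant coefficients that is positive on future-directed
   causal vectors; local finiteness is obtained by multiplying with factors
   vanishing where one of the previous bump functions is large. *)

Set Implicit Arguments.
Unset Strict Implicit.
Unset Printing Implicit Defensive.

Import Order.TTheory GRing.Theory Num.Theory.
Import numFieldNormedType.Exports.

Local Open Scope classical_set_scope.
Local Open Scope ring_scope.

(** * Calculus of [Ck_on] functions *)

(** Scaling one fixed covector field by a small constant does not suffice: if [M] is not compact,
    the tolerances [e i] may have no positive lower bound, and a variable factor on [M] would have
    to be constant along the leaves for the Lie derivatives to stay zero. The smallness is therefore
    arranged on [B], by the coefficients of the sum. These are fixed once and for all, while the
    number of terms needed at a point is not bounded; hence the k-th term is allotted the share
    [eta i / 2 ^+ k.+1] of the bound. On a given causal vector all terms have the same sign, so that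
    they cannot cancel and the sum needs no normalisation. The new future wedge at a point is the
    component that contains the old one. [Ck_on] speaks of directional derivatives only, whereas the
    chain rule needs differentiability and the Lie derivative of a pullback needs commuting second
    derivatives; both are derived from the mean value theorem. *)

Section CkBasics.
Variables (R : realType) (V W : normedModType R).
Implicit Types (U : set V) (f g : V -> W).

Lemma Ck_on_continuous k U f x : Ck_on k U f -> U x -> {for x, continuous f}.
Proof. by case: k => [|k] [cf _]; exact: cf. Qed.

Lemma Ck_on_derivable k U f x v : Ck_on k.+1 U f -> U x -> derivable f x v.
Proof. by move=> [_ /(_ v)[df _]]; exact: df. Qed.

Lemma Ck_on_derive k U f v : Ck_on k.+1 U f -> Ck_on k U ('D_v f).
Proof. by move=> [_ /(_ v)[]]. Qed.

Lemma Ck_onS k U f : Ck_on k.+1 U f -> Ck_on k U f.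
Proof.
elim: k f => [|k IH] f [cf df]; split=> // v.
by have [dfv Cf] := df v; split=> //; exact: IH.
Qed.

(** Every condition in [Ck_on] is imposed at a single point, on functions defined on all of [V], so
    the sets [U'] may be arbitrary. *)
Lemma Ck_on_local k U f :
  (forall x, U x -> exists2 U', U' x & Ck_on k U' f) -> Ck_on k U f.
Proof.
elim: k f => [|k IH] f loc.
  by split=> // x /loc[U' U'x] /Ck_on_continuous; exact.
split=> [x /loc[U' U'x] /Ck_on_continuous|v]; first exact.
split=> [x /loc[U' U'x] /Ck_on_derivable|]; first exact.
by apply: IH => x /loc[U' U'x] /Ck_on_derive CU'; exists U'.
Qed.

Lemma near_eq_on U f g x : (forall y, U y -> f y = g y) -> open U -> U x ->
  {near x, f =1 g}.
Proof. by move=> fg oU Ux; apply: filterS fg _; exact: open_nbhs_nbhs. Qed.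

(** Formulas for derivatives hold only on [U], where the functions are derivable; this lemma makes
    them usable in inductions on [k]. As [U] is open, agreement on [U] passes to the derivatives. *)
Lemma Ck_on_near k U f g : open U -> (forall x, U x -> f x = g x) ->
  Ck_on k U f -> Ck_on k U g.
Proof.
move=> oU; elim: k f g => [|k IH] f g fg [cf df].
  split=> // x Ux; have nfg := near_eq_on fg oU Ux.
  suff: g @ x --> g x by [].
  by rewrite -(fg x Ux); apply: cvg_trans (cf x Ux); exact: near_eq_cvg.
have nfg x (Ux : U x) := near_eq_on fg oU Ux.
split=> [x Ux|].
  suff: g @ x --> g x by [].
  rewrite -(fg x Ux); apply: cvg_trans (cf x Ux); apply: near_eq_cvg.
  exact: nfg.
move=> v; have [dfv Cf] := df v; split=> [x Ux|].
  exact: near_eq_derivable (nfg x Ux) (dfv x Ux).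
apply: IH Cf => x Ux; exact: near_eq_derive (nfg x Ux).
Qed.

Lemma smooth_on_local U f :
  (forall x, U x -> exists U' g, [/\ open U', U' x, smooth_on U' g &
     forall y, U' y -> g y = f y]) -> smooth_on U f.
Proof.
move=> loc k; apply: Ck_on_local => x /loc[U' [g [oU' U'x Cg gf]]].
by exists U' => //; exact: Ck_on_near gf (Cg k).
Qed.

Lemma smooth_onW U U' f : U `<=` U' -> smooth_on U' f -> smooth_on U f.
Proof.
move=> sub Cf k; apply: Ck_on_local => x /sub U'x.
by exists U' => //; exact: Cf.
Qed.

Lemma Ck_on_cst k U (a : W) : Ck_on k U (fun=> a).
Proof.
elim: k a => [|k IH] a; split=> [x _|//]; try exact: cst_continuous.
move=> v; split=> [x _|]; first exact: derivable_cst.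
by under eq_fun do rewrite derive_cst; exact: IH.
Qed.

Lemma Ck_onD k U f g : open U -> Ck_on k U f -> Ck_on k U g ->
  Ck_on k U (fun x => f x + g x).
Proof.
move=> oU; elim: k f g => [|k IH] f g [cf df] [cg dg].
  by split=> // x Ux; exact: continuousD (cf x Ux) (cg x Ux).
split=> [x Ux|]; first exact: continuousD (cf x Ux) (cg x Ux).
move=> v; have [dfv Cf] := df v; have [dgv Cg] := dg v; split=> [x Ux|].
  exact: derivableD (dfv x Ux) (dgv x Ux).
apply: Ck_on_near (IH _ _ Cf Cg) => // x Ux.
exact: esym (deriveD (dfv x Ux) (dgv x Ux)).
Qed.

Lemma Ck_on_sum (I : Type) (r : seq I) (P : pred I) k U (f : I -> V -> W) :
  open U -> (forall i, P i -> Ck_on k U (f i)) ->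
  Ck_on k U (fun x => \sum_(i <- r | P i) f i x).
Proof.
move=> oU Cf; elim: r => [|i r IH].
  have -> : (fun x => \sum_(i <- [::] | P i) f i x) = (fun=> 0).
    by apply/funext => x; rewrite big_nil.
  exact: Ck_on_cst.
have [Pi|nPi] := boolP (P i); last first.
  suff -> : (fun x => \sum_(j <- i :: r | P j) f j x) =
            (fun x => \sum_(j <- r | P j) f j x) by [].
  by apply/funext => x; rewrite big_cons (negbTE nPi).
suff -> : (fun x => \sum_(j <- i :: r | P j) f j x) =
          (fun x => f i x + \sum_(j <- r | P j) f j x).
  exact: Ck_onD (Cf i Pi) IH.
by apply/funext => x; rewrite big_cons Pi.
Qed.

End CkBasics.

Section CkScalar.
Variables (R : realType) (V : normedModType R).
Implicit Types (U : set V) (f g : V -> R).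

Lemma Ck_on_id k (U : set V) : Ck_on k U (@id V).
Proof.
case: k => [|k]; split=> [x _|//]; try (by apply: cvg_id).
move=> v; split=> [x _|]; first exact: derivable_id.
by under eq_fun do rewrite derive_id; exact: Ck_on_cst.
Qed.

Lemma Ck_onM k U f g : open U -> Ck_on k U f -> Ck_on k U g ->
  Ck_on k U (fun x => f x * g x).
Proof.
move=> oU; elim: k f g => [|k IH] f g Cf Cg.
  split=> // x Ux.
  exact: continuousM (Ck_on_continuous Cf Ux) (Ck_on_continuous Cg Ux).
split=> [x Ux|v].
  exact: continuousM (Ck_on_continuous Cf Ux) (Ck_on_continuous Cg Ux).
split=> [x Ux|].
  exact: (derivableM (Ck_on_derivable Cf Ux) (Ck_on_derivable Cg Ux)).
have C1 := IH _ _ (Ck_onS Cf) (Ck_on_derive v Cg).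
have C2 := IH _ _ (Ck_onS Cg) (Ck_on_derive v Cf).
apply: Ck_on_near (Ck_onD oU C1 C2) => // x Ux.
have := @deriveM _ _ f g x v (Ck_on_derivable Cf Ux) (Ck_on_derivable Cg Ux).
by rewrite /GRing.scale /= => <-; congr derive.
Qed.

End CkScalar.

(** * Matrix-valued functions, entry by entry *)

Section CkMatrix.
Variables (R : realType) (V : normedModType R).
Implicit Types (U : set V).

Lemma continuous_mxP m n (f : V -> 'M[R]_(m, n)) x :
  {for x, continuous f} <-> forall i j, {for x, continuous (fun y => f y i j)}.
Proof.
split=> [cf i j|cf].
  exact: continuous_comp cf (@coord_continuous _ _ _ i j (f x)).
rewrite /continuous_at; apply/cvgrPdist_le => /= e e0; near=> y.
rewrite /Num.Def.normr/= mx_normrE (bigmax_le _ (ltW e0))//= => i _.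
rewrite !mxE/=.
move: i; near: y; apply: filter_forall => /= i.
exact: ((cvgrPdist_le _ _).1 (cf i.1 i.2)).
Unshelve. all: by end_near. Qed.

Lemma Ck_on_mxP m n k U (f : V -> 'M[R]_(m, n)) : open U ->
  Ck_on k U f <-> forall i j, Ck_on k U (fun x => f x i j).
Proof.
move=> oU; elim: k f => [|k IH] f; split.
- by move=> [cf _] i j; split=> // x /cf /continuous_mxP.
- move=> cf; split=> // x Ux; apply/continuous_mxP => i j.
  by have [+ _] := cf i j; exact.
- move=> [cf df] i j; split=> [x /cf /continuous_mxP //|v].
  have [dfv Cf] := df v; split=> [x /dfv /derivable_mxP //|].
  apply: Ck_on_near ((IH _).1 Cf i j) => // x Ux.
  by rewrite derive_mx ?mxE//; exact: dfv.
- move=> Cf.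
  have dfv v x : U x -> derivable f x v.
    by move=> Ux; apply/derivable_mxP => i j; exact: Ck_on_derivable (Cf i j) Ux.
  split=> [x Ux|v].
    by apply/continuous_mxP => i j; exact: Ck_on_continuous (Cf i j) Ux.
  split; first exact: dfv.
  apply/IH => i j; apply: Ck_on_near (Ck_on_derive v (Cf i j)) => // x Ux.
  by rewrite derive_mx ?mxE//; exact: dfv.
Qed.

Lemma Ck_on_mulmx m n p k U (f : V -> 'M[R]_(m, n)) (g : V -> 'M[R]_(n, p)) :
  open U -> Ck_on k U f -> Ck_on k U g -> Ck_on k U (fun x => f x *m g x).
Proof.
move=> oU /Ck_on_mxP-/(_ oU) Cf /Ck_on_mxP-/(_ oU) Cg; apply/Ck_on_mxP => // i j.
under eq_fun do rewrite mxE; apply: Ck_on_sum => // l _.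
by apply: Ck_onM; [|exact: Cf|exact: Cg].
Qed.

Lemma Ck_on_trmx m n k U (f : V -> 'M[R]_(m, n)) :
  open U -> Ck_on k U f -> Ck_on k U (fun x => (f x)^T).
Proof.
move=> oU /Ck_on_mxP-/(_ oU) Cf; apply/Ck_on_mxP => // i j.
by under eq_fun do rewrite mxE; exact: Cf.
Qed.

Lemma Ck_onZ m n k U (a : V -> R) (f : V -> 'M[R]_(m, n)) :
  open U -> Ck_on k U a -> Ck_on k U f -> Ck_on k U (fun x => a x *: f x).
Proof.
move=> oU Ca /Ck_on_mxP-/(_ oU) Cf; apply/Ck_on_mxP => // i j.
by under eq_fun do rewrite mxE; apply: Ck_onM => //; exact: Cf.
Qed.

Lemma is_derive_mulmx m n p (f : V -> 'M[R]_(m, n)) (g : V -> 'M[R]_(n, p))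
    x v :
  derivable f x v -> derivable g x v ->
  is_derive x v (fun y => f y *m g y) ('D_v f x *m g x + f x *m 'D_v g x).
Proof.
move=> df dg.
have dfi i j : derivable (fun y => f y i j) x v by move/derivable_mxP: df.
have dgi i j : derivable (fun y => g y i j) x v by move/derivable_mxP: dg.
have dij i j : is_derive x v (fun y => (f y *m g y) i j)
    (('D_v f x *m g x + f x *m 'D_v g x) i j).
  have -> : (fun y => (f y *m g y) i j) =
      \sum_(l < n) ((fun y => f y i l) * (fun y => g y l j)).
    by apply/funext => y; rewrite mxE fct_sumE.
  apply: is_derive_eq (is_derive_sum (fun l =>
    is_deriveM (derivableP (dfi i l)) (derivableP (dgi l j)))) _.
  rewrite !mxE -big_split /=; apply: eq_bigr => l _.
  by rewrite !derive_mx// !mxE /GRing.scale /= addrC; congr (_ + _); rewrite mulrC.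
have dfg : derivable (fun y => f y *m g y) x v.
  by apply/derivable_mxP => i j; case: (dij i j).
split=> //; rewrite derive_mx //; apply/matrixP => i j; rewrite mxE.
by have [_ ->] := dij i j.
Qed.

End CkMatrix.

(** * Mean values along lines: additivity of the derivative in the direction, symmetry of second
    derivatives *)

Section MeanValue.
Variables (R : realType) (V : normedModType R).
Implicit Types (U : set V) (f : V -> R).

Lemma is_derive_line f y v t : derivable f (y + t *: v) v ->
  is_derive t 1 (fun s : R => f (y + s *: v)) ('D_v f (y + t *: v)).
Proof.
move=> df; have E : (fun h : R =>
      h^-1 *: (((fun s => f (y + s *: v)) \o shift t) (h *: (1 : R)) -
        f (y + t *: v))) =
  (fun h => h^-1 *: ((f \o shift (y + t *: v)) (h *: v) - f (y + t *: v))).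
  apply/funext => h /=; congr (_ *: (f _ - _)).
  by rewrite [h *: 1]mulr1 scalerDl addrCA.
by split; [rewrite /derivable E|rewrite /derive E].
Qed.

(** Only the derivative in the direction [v] is available, so the one-variable chain rule is applied
    to [s |-> f (x + s *: v)] after [s |-> s * a]; this includes [a = 0]. *)
Lemma is_deriveZv f x v a : derivable f x v ->
  is_derive x (a *: v) f (a * 'D_v f x).
Proof.
move=> df; have df0 : derivable f (x + (0 : R) *: v) v by rewrite scale0r addr0.
have l0 := is_derive_line df0.
have lin : is_derive (0 : R) (1 : R) (fun s : R => s * a) a.
  apply: is_derive_eq (is_deriveM (is_derive_id _ _) (is_derive_cst a _ _)) _.
  by rewrite /GRing.scale /= mul0r mulr1 add0r.
have E : (fun h : R => h^-1 *: ((f \o shift x) (h *: (a *: v)) - f x)) =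
  (fun h : R => h^-1 *:
    ((((fun s : R => f (x + s *: v)) \o (fun s => s * a)) \o shift 0)
     (h *: (1 : R)) - ((fun s : R => f (x + s *: v)) \o (fun s => s * a)) 0)).
  apply/funext => h /=; congr (_ *: (f _ - f _)).
    by rewrite [h *: 1]mulr1 addr0 scalerA addrC.
  by rewrite mul0r scale0r addr0.
have d2 : derivable (fun s : R => f (x + s *: v)) (0 * a) 1.
  by rewrite mul0r; case: l0.
have d1 : derivable (fun s : R => s * a) 0 1 by case: lin.
split; first rewrite /derivable E.
  apply/derivable1_diffP.
  exact: (@differentiable_comp _ _ _ _ (fun s : R => s * a)
    (fun s : R => f (x + s *: v)) 0 ((derivable1_diffP _ _).1 d1)
    ((derivable1_diffP _ _).1 d2)).
rewrite /derive E.
rewrite -[LHS]/('D_1 ((fun s : R => f (x + s *: v)) \o (fun s => s * a)) 0).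
rewrite -derive1E (derive1_comp d1 d2) !derive1E.
case: lin => _ ->; rewrite mul0r; case: l0 => _ ->.
by rewrite scale0r addr0 mulrC.
Qed.

Lemma MVT_line f y v t : 0 <= t ->
  (forall s, 0 <= s <= t -> derivable f (y + s *: v) v) ->
  exists2 s, 0 <= s <= t & f (y + t *: v) - f y = t * 'D_v f (y + s *: v).
Proof.
move=> t0 df.
have [||c] := @MVT_segment R (fun s : R => f (y + s *: v))
    (fun s => 'D_v f (y + s *: v)) 0 t t0.
- move=> s; rewrite in_itv /= => /andP[s0 st].
  by apply/is_derive_line/df; rewrite !ltW.
- apply: derivable_within_continuous => s; rewrite in_itv /= => st.
  by case: (is_derive_line (df s st)).
- rewrite in_itv /= subr0 scale0r addr0 => ct ->.
  by exists c => //; rewrite mulrC.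
Qed.

Lemma nbhs_parallelogram (x u v : V) (P : set V) : nbhs x P ->
  exists2 d : R, 0 < d & forall s t, 0 <= s <= d -> 0 <= t <= d ->
    P (x + s *: u + t *: v).
Proof.
move=> /nbhs_ballP[e /= e0 eP].
(* The summand 1 keeps [M] positive when [u = v = 0] and makes the final bound strict. *)
pose M := `|u| + `|v| + 1.
have M0 : 0 < M by rewrite /M ltr_wpDl// addr_ge0.
exists (e / M); first exact: divr_gt0.
move=> s t /andP[s0 sd] /andP[t0 td]; apply: eP.
rewrite -ball_normE /= opprD addrA opprD addrA subrr add0r -opprD normrN.
apply: le_lt_trans (ler_normD _ _) _; rewrite !normrZ !ger0_norm//.
apply: (@le_lt_trans _ _ (e / M * (`|u| + `|v|))).
  by rewrite mulrDr lerD// ler_wpM2r.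
by rewrite mulrAC ltr_pdivrMr// ltr_pM2l// /M ltrDl.
Qed.

(** The increment of [f] from [x] to [x + d *: (u + v)] is computed along the diagonal and along two
    sides of a parallelogram. Mean values turn this into an equation between derivatives at three
    points near [x], each within [e / 3] of its value at [x]. *)
Lemma deriveDv f U x u v : open U -> U x -> Ck_on 1 U f ->
  'D_(u + v) f x = 'D_u f x + 'D_v f x.
Proof.
move=> oU Ux Cf; apply/eqP; rewrite -subr_eq0 -normr_le0.
apply/ler_addgt0Pl => e e0; rewrite addr0.
have e3 : 0 < e / 3 by rewrite divr_gt0.
have cD w : \forall y \near x, `|'D_w f x - 'D_w f y| <= e / 3.
  have := Ck_on_continuous (Ck_on_derive w Cf) Ux.
  by move/cvgrPdist_le => /(_ _ e3).
have nU : \forall y \near x, U y by exact: open_nbhs_nbhs.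
have [d d0 dP] := nbhs_parallelogram u v (filterI (filterI nU (cD (u + v)))
  (filterI (cD u) (cD v))).
have dd : 0 <= d <= d by rewrite ltW /=.
have d00 : 0 <= (0:R) <= d by rewrite lexx ltW.
have [|s1 s1d E1] := @MVT_line f x (u + v) d (ltW d0).
  move=> s sd; have [[Uy _] _] := dP _ _ sd sd.
  by apply: Ck_on_derivable Cf _; rewrite scalerDr addrA.
have [|s2 s2d E2] := @MVT_line f x u d (ltW d0).
  move=> s sd; have [[Uy _] _] := dP _ _ sd d00.
  by apply: Ck_on_derivable Cf _; rewrite scale0r addr0 in Uy.
have [|s3 s3d E3] := @MVT_line f (x + d *: u) v d (ltW d0).
  move=> s sd; have [[Uy _] _] := dP _ _ dd sd.
  exact: Ck_on_derivable Cf _.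
have E : 'D_(u + v) f (x + s1 *: (u + v)) =
   'D_u f (x + s2 *: u) + 'D_v f (x + d *: u + s3 *: v).
  apply: (@mulfI _ d); first by rewrite gt_eqF.
  by rewrite mulrDr -E1 -E2 -E3 scalerDr addrA; ring.
have [[_ h1] _] := dP _ _ s1d s1d.
have [_ [h2 _]] := dP _ _ s2d d00.
have [_ [_ h3]] := dP _ _ dd s3d.
rewrite /= -addrA -scalerDr in h1; rewrite /= scale0r addr0 in h2.
rewrite E in h1; clear E E1 E2 E3.
move: ('D_(u + v) _ x) ('D_u _ x) ('D_v _ x) h1 h2 h3.
move: ('D_u _ _) ('D_v _ _) => a b a' b' c'.
by rewrite !ler_norml; lra.
Qed.

(** The second difference of [f] over a small parallelogram is symmetric in the two sides, and
    equals [d * d] times a value of either mixed derivative near [x]. *)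
Lemma derive_sym f U x u v : open U -> U x -> Ck_on 2 U f ->
  'D_u ('D_v f) x = 'D_v ('D_u f) x.
Proof.
move=> oU Ux Cf; apply/eqP; rewrite -subr_eq0 -normr_le0.
apply/ler_addgt0Pl => e e0; rewrite addr0.
have e3 : 0 < e / 2 by rewrite divr_gt0.
have cD w w' : \forall y \near x, `|'D_w ('D_w' f) x - 'D_w ('D_w' f) y| <= e / 2.
  have := Ck_on_continuous (Ck_on_derive w (Ck_on_derive w' Cf)) Ux.
  by move/cvgrPdist_le => /(_ _ e3).
have nU : \forall y \near x, U y by exact: open_nbhs_nbhs.
have [d d0 dP] := nbhs_parallelogram u v (filterI nU
  (filterI (cD u v) (cD v u))).
have dd : 0 <= d <= d by rewrite ltW /=.
have d00 : 0 <= (0:R) <= d by rewrite lexx ltW.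
(* Two mean values: for [F y = f (y + d *: w') - f y] in the direction [w], then for ['D_w f] in the
   direction [w']. *)
have step (w w' : V) :
  (forall s t, 0 <= s <= d -> 0 <= t <= d -> U (x + s *: w + t *: w')) ->
  exists s t, [/\ 0 <= s <= d, 0 <= t <= d &
    f (x + d *: w + d *: w') - f (x + d *: w) - f (x + d *: w') + f x =
    d * (d * 'D_w' ('D_w f) (x + s *: w + t *: w'))].
  move=> UP.
  have dfy y z : U y -> derivable f y z by exact: Ck_on_derivable (Ck_onS Cf).
  have Uw s : 0 <= s <= d -> U (x + s *: w).
    by move=> sd; have := UP _ _ sd d00; rewrite scale0r addr0.
  pose F y := f (y + d *: w') - f y.
  have sh s : 0 <= s <= d -> 
      is_derive (x + s *: w) w (fun y => f (y + d *: w'))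
        ('D_w f (x + s *: w + d *: w')).
    move=> sd; have Uy := UP _ _ sd dd.
    have E : (fun h : R =>
        h^-1 *: (((fun y => f (y + d *: w')) \o shift (x + s *: w)) (h *: w) -
          f (x + s *: w + d *: w'))) =
      (fun h => h^-1 *: ((f \o shift (x + s *: w + d *: w')) (h *: w) -
          f (x + s *: w + d *: w'))).
      by apply/funext => h /=; congr (_ *: (f _ - _)); rewrite -!addrA.
    by split; [rewrite /derivable E; exact: dfy|rewrite /derive E].
  have dF s : 0 <= s <= d -> is_derive (x + s *: w) w F
      ('D_w f (x + s *: w + d *: w') - 'D_w f (x + s *: w)).
    move=> sd; apply: is_deriveB; first exact: sh.
    by apply: derivableP; apply: dfy; exact: Uw.
  have [|s sd E1] := @MVT_line F x w d (ltW d0).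
    by move=> s /dF[].
  have [|t td E2] := @MVT_line ('D_w f) (x + s *: w) w' d (ltW d0).
    by move=> t td; apply: Ck_on_derivable (Ck_on_derive w Cf) _; exact: UP.
  exists s, t; split=> //; rewrite -E2 -(derive_val (is_derive := dF s sd)) -E1 /F.
  by rewrite (addrAC x); ring.
have [s1 [t1 [s1d t1d E1]]] := step u v (fun s t sd td => (dP s t sd td).1).
have UP' s t : 0 <= s <= d -> 0 <= t <= d -> U (x + s *: v + t *: u).
  by move=> sd td; rewrite addrAC; exact: (dP _ _ td sd).1.
have [s2 [t2 [s2d t2d E2]]] := step v u UP'.
have [_ [_ h1]] := dP _ _ s1d t1d.
have [_ [h2 _]] := dP _ _ t2d s2d.
have E : 'D_v ('D_u f) (x + s1 *: u + t1 *: v) = 'D_u ('D_v f) (x + t2 *: u + s2 *: v).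
  apply: (@mulfI _ d); first by rewrite gt_eqF.
  apply: (@mulfI _ d); first by rewrite gt_eqF.
  apply: etrans (esym E1) _.
  rewrite (addrAC x (s2 *: v)) (addrAC x (d *: v)) in E2.
  by apply: etrans _ E2; congr (_ + _); exact: addrAC.
rewrite /= E in h1; clear E E1 E2.
move: ('D_v _ x) ('D_u _ x) ('D_u _ _) h1 h2 => a b c.
by rewrite !ler_norml; lra.
Qed.

End MeanValue.

(** * Continuous directional derivatives imply differentiability *)

Section Differentiability.
Variables (R : realType) (n : nat).
Implicit Types (U : set 'rV[R]_n).

Lemma derive_coord U (f : 'rV[R]_n -> R) x v : open U -> U x -> Ck_on 1 U f ->
  'D_v f x = \sum_j v 0 j * 'D_(delta_mx 0 j) f x.
Proof.
move=> oU Ux Cf; rewrite [in LHS](row_sum_delta v).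
elim: (index_enum _) => [|j r IH]; first by rewrite !big_nil derive0.
rewrite !big_cons (deriveDv _ _ oU Ux Cf) IH; congr (_ + _).
by case: (is_deriveZv (v 0 j) (Ck_on_derivable (v := delta_mx 0 j) Cf Ux)).
Qed.

Lemma mx_entry_le m p (A : 'M[R]_(m, p)) i j : `|A i j| <= `|A|.
Proof.
rewrite [leRHS]/Num.Def.normr/= mx_normrE.
exact: (le_bigmax _ (fun k => `|A k.1 k.2|) (i, j)).
Qed.

(** The differential is obtained by choice from the maps satisfying the expansion at [x], so one
    such map [L] is enough. *)
Lemma differentiable_littleo (V W : normedModType R) (f : V -> W)
    (L : {linear V -> W}) x : continuous L ->
  (forall e, 0 < e -> \forall y \near x,
     `|f y - f x - L (y - x)| <= e * `|y - x|) -> differentiable f x.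
Proof.
move=> cL fL.
apply/diffP; apply: (@getPex _ (fun df : {linear V -> W} => continuous df /\
  forall y, f y = f (lim (nbhs x)) + df (y - lim (nbhs x))
                  +o_(y \near x) (y - lim (nbhs x)))).
exists L; split=> //; rewrite lim_id //.
have : f = (fun y => f x + L (y - x)) +o_x (fun y => y - x).
  apply/eqaddoP => e e0; apply: filterS (fL e e0) => y.
  by rewrite -[(f - _) y]/(f y - (f x + L (y - x))) opprD addrA.
by rewrite funeqE.
Qed.

(** By the mean value theorem [f y - f x] is the derivative in the direction [y - x] at a point of
    the segment; its coordinate expansion is compared with the one at [x], using continuity of the
    partial derivatives. *)
Lemma C1_differentiable_scalar U (f : 'rV[R]_n -> R) x :
  open U -> U x -> Ck_on 1 U f -> differentiable f x.
Proof.
move=> oU Ux Cf.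
pose L (v : 'rV[R]_n) : R := \sum_j v 0 j * 'D_(delta_mx 0 j) f x.
have Llin : linear L.
  move=> a u v; rewrite /L scaler_sumr -big_split; apply: eq_bigr => j _ /=.
  by rewrite !mxE mulrDl /GRing.scale /= mulrA.
pose LM := GRing.isLinear.Build _ _ _ _ _ Llin.
pose LL : {linear 'rV[R]_n -> R} := HB.pack L LM.
apply: (@differentiable_littleo _ _ f LL).
  rewrite -[X in continuous X]/L => v.
  have -> : L = \sum_j (fun u : 'rV[R]_n => u 0 j * 'D_(delta_mx 0 j) f x).
    by apply/funext => u; rewrite fct_sumE.
  apply: differentiable_continuous; apply: differentiable_sum => j.
  by apply: differentiableM => //; exact: differentiable_coord.
(* Each of the [n] partial derivatives may be off by [d]; the successor avoids a division by 0 when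
   [n = 0]. *)
move=> e e0; pose d := e / n.+1%:R.
have d0 : 0 < d by rewrite divr_gt0.
have nU : \forall y \near x, U y by exact: open_nbhs_nbhs.
have nD : \forall y \near x, forall j : 'I_n,
    `|'D_(delta_mx 0 j) f x - 'D_(delta_mx 0 j) f y| <= d.
  apply: (@filter_forall _ _ (fun j y =>
    `|'D_(delta_mx 0 j) f x - 'D_(delta_mx 0 j) f y| <= d) (nbhs x) _) => j.
  have := Ck_on_continuous (Ck_on_derive (delta_mx 0 j) Cf) Ux.
  by move/cvgrPdist_le => /(_ _ d0).
have [r /= r0 rP] := (nbhs_ballP _ _).1 (filterI nU nD).
apply/nbhs_ballP; exists r => //= y xy; pose v := y - x.
have seg s : 0 <= s <= 1 -> ball x r (x + s *: v).
  move=> /andP[s0 s1]; rewrite -ball_normE /= opprD addrA subrr add0r normrN.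
  rewrite normrZ ger0_norm//; apply: le_lt_trans (_ : `|v| < r).
    by rewrite ler_piMl.
  by move: xy; rewrite -ball_normE /= /v distrC.
have [|s s1 ] := @MVT_line _ _ f x v 1 ler01.
  by move=> s /seg/rP[Uy _]; apply: Ck_on_derivable Cf Uy.
have [Us Ds] := rP _ (seg _ s1).
rewrite scale1r mul1r {1}/v [x + _]addrC subrK => E.
change (`|f y - f x - L v| <= e * `|v|); rewrite E.
rewrite (derive_coord _ oU Us Cf) /L -sumrB.
apply: le_trans (ler_norm_sum _ _ _) _.
apply: (@le_trans _ _ (\sum_(j < n) d * `|v|)).
  apply: ler_sum => j _; rewrite -mulrBr normrM mulrC.
  by rewrite ler_pM // ?mx_entry_le // distrC.
rewrite sumr_const card_ord -[_ *+ _]mulr_natl mulrA ler_wpM2r//.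
rewrite /d mulrCA; apply: ler_piMr; first exact: ltW.
by rewrite ler_pdivrMr// mul1r ler_nat.
Qed.

Lemma differentiable_mxP (V : normedModType R) m p (f : V -> 'M[R]_(m, p)) x :
  (forall i j, differentiable (fun y => f y i j) x) -> differentiable f x.
Proof.
move=> df.
pose L (v : V) : 'M[R]_(m, p) := \matrix_(i, j) 'd (fun y => f y i j) x v.
have Llin : linear L.
  by move=> a u v; apply/matrixP => i j; rewrite !mxE linearP.
pose LM := GRing.isLinear.Build _ _ _ _ _ Llin.
pose LL : {linear V -> 'M[R]_(m, p)} := HB.pack L LM.
apply: (@differentiable_littleo _ _ f LL).
  rewrite -[X in continuous X]/L => v.
  apply/continuous_mxP => i j.
  have -> : (fun y => L y i j) = 'd (fun y => f y i j) x.
    by apply/funext => y; rewrite mxE.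
  exact: diff_continuous.
move=> e e0; have : \forall y \near x, forall ij : 'I_m * 'I_p,
    `|f y ij.1 ij.2 - f x ij.1 ij.2 - 'd (fun y => f y ij.1 ij.2) x (y - x)| <=
     e * `|y - x|.
  apply: (@filter_forall _ _ (fun ij y =>
    `|f y ij.1 ij.2 - f x ij.1 ij.2 - 'd (fun y => f y ij.1 ij.2) x (y - x)| <=
    e * `|y - x|) (nbhs x) _) => -[i j] /=.
  have /diffE := df i j; rewrite lim_id // => E.
  have {}E : (fun y => f y i j) =
      (fun y => f x i j + 'd (fun y => f y i j) x (y - x)) +o_x (fun y => y - x).
    by rewrite funeqE.
  move/eqaddoP : E => /(_ e e0); apply: filterS => y.
  rewrite -[((_ : _ -> _) - _) y]/(f y i j -
    (f x i j + 'd (fun y => f y i j) x (y - x))).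
  by rewrite opprD addrA.
apply: filterS => y le; change (`|f y - f x - L (y - x)| <= e * `|y - x|).
rewrite [leLHS]/Num.Def.normr/= mx_normrE; apply: bigmax_le => [|ij _].
  by rewrite mulr_ge0// ltW.
by rewrite !mxE; exact: le.
Qed.

Lemma C1_differentiable U m p (f : 'rV[R]_n -> 'M[R]_(m, p)) x :
  open U -> U x -> Ck_on 1 U f -> differentiable f x.
Proof.
move=> oU Ux /(Ck_on_mxP _ _ oU) Cf; apply: differentiable_mxP => i j.
exact: C1_differentiable_scalar (Cf i j).
Qed.

End Differentiability.

(** * Chain rule and Jacobians *)

Section Composition.
Variable R : realType.

Lemma derive_comp n m (W : normedModType R) (f : 'rV[R]_n -> 'rV[R]_m)
    (g : 'rV[R]_m -> W) x v : differentiable f x -> differentiable g (f x) ->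
  'D_v (g \o f) x = 'D_('D_v f x) g (f x).
Proof.
move=> df dg; rewrite deriveE; last exact: differentiable_comp.
by rewrite diff_comp // !deriveE.
Qed.

(** The derivative of [g \o f] is a sum of products of a derivative of [f] with a partial derivative
    of [g] composed with [f]; the second factor is handled by induction. *)
Lemma Ck_on_comp_scalar n m k (U : set 'rV[R]_n) (U' : set 'rV[R]_m)
    (f : 'rV[R]_n -> 'rV[R]_m) (g : 'rV[R]_m -> R) :
  open U -> open U' -> (forall x, U x -> U' (f x)) ->
  Ck_on k U f -> Ck_on k U' g -> Ck_on k U (g \o f).
Proof.
move=> oU oU' UU'; elim: k g => [|k IH] g Cf Cg.
  split=> // x Ux.
  exact: continuous_comp (Ck_on_continuous Cf Ux) (Ck_on_continuous Cg (UU' _ Ux)).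
have C1 : forall (V W : normedModType R) (A : set V) (h : V -> W),
    Ck_on k.+1 A h -> Ck_on 1 A h.
  by move=> V W A h; elim: k {IH Cf Cg} => // k IH /Ck_onS.
have dfx x : U x -> differentiable f x.
  by move=> Ux; exact: C1_differentiable oU Ux (C1 _ _ _ _ Cf).
have dgx x : U x -> differentiable g (f x).
  by move=> Ux; exact: C1_differentiable_scalar oU' (UU' _ Ux) (C1 _ _ _ _ Cg).
split=> [x Ux|v].
  exact: continuous_comp (Ck_on_continuous Cf Ux) (Ck_on_continuous Cg (UU' _ Ux)).
split=> [x Ux|].
  by apply: diff_derivable; apply: differentiable_comp; [exact: dfx|exact: dgx].
have E x : U x -> \sum_j 'D_v f x 0 j * ('D_(delta_mx 0 j) g \o f) x =
    'D_v (g \o f) x.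
  move=> Ux; rewrite (derive_comp v (dfx _ Ux) (dgx _ Ux)).
  by rewrite (derive_coord _ oU' (UU' _ Ux) (C1 _ _ _ _ Cg)).
apply: Ck_on_near E _ => //; apply: Ck_on_sum => // j _; apply: Ck_onM => //.
  by have /(Ck_on_mxP _ _ oU) := Ck_on_derive v Cf; exact.
apply: IH; first exact: Ck_onS.
exact: Ck_on_derive.
Qed.

Lemma Ck_on_comp n m k p q (U : set 'rV[R]_n) (U' : set 'rV[R]_m)
    (f : 'rV[R]_n -> 'rV[R]_m) (g : 'rV[R]_m -> 'M[R]_(p, q)) :
  open U -> open U' -> (forall x, U x -> U' (f x)) ->
  Ck_on k U f -> Ck_on k U' g -> Ck_on k U (g \o f).
Proof.
move=> oU oU' UU' Cf /(Ck_on_mxP _ _ oU') Cg; apply/(Ck_on_mxP _ _ oU) => i j.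
exact: Ck_on_comp_scalar oU oU' UU' Cf (Cg i j).
Qed.

(** Vectors are rows, hence the Jacobian of the map applied first stands on the left. *)
Lemma jacobian_comp n m p (f : 'rV[R]_n -> 'rV[R]_m) (g : 'rV[R]_m -> 'rV[R]_p) x :
  differentiable f x -> differentiable g (f x) ->
  'J (g \o f) x = 'J f x *m 'J g (f x).
Proof.
move=> df dg; apply/row_matrixP => i.
rewrite (rowE i ('J (g \o f) x)) (rowE i ('J f x *m 'J g (f x))) mulmxA.
have dgf : differentiable (g \o f) x by exact: differentiable_comp.
rewrite -(deriveEjacobian _ dgf) -(deriveEjacobian _ df).
by rewrite -(deriveEjacobian _ dg) derive_comp.
Qed.

Lemma row_jacobian n m (f : 'rV[R]_n -> 'rV[R]_m) x i :
  differentiable f x -> row i ('J f x) = 'D_(delta_mx 0 i) f x.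
Proof. by move=> df; rewrite rowE deriveEjacobian. Qed.

Lemma jacobian_near n m (f g : 'rV[R]_n -> 'rV[R]_m) x :
  differentiable f x -> differentiable g x -> {near x, f =1 g} ->
  'J f x = 'J g x.
Proof.
move=> df dg fg; apply/row_matrixP => i.
apply: etrans (row_jacobian i df) _; apply: etrans (esym (row_jacobian i dg)).
exact: near_eq_derive.
Qed.

Lemma jacobian_id n (x : 'rV[R]_n) : 'J id x = 1%:M.
Proof.
apply/row_matrixP => i.
have did : differentiable (@id 'rV[R]_n) x by apply: ex_diff.
by rewrite (row_jacobian _ did) derive_id row1.
Qed.

Lemma Ck_on_jacobian n m k (U : set 'rV[R]_n) (f : 'rV[R]_n -> 'rV[R]_m) :
  open U -> Ck_on k.+1 U f -> Ck_on k U (fun x => 'J f x).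
Proof.
move=> oU Cf; have C1 : Ck_on 1 U f.
  by elim: k Cf => // k IH /Ck_onS.
apply/(Ck_on_mxP _ _ oU) => i j.
have /(Ck_on_mxP _ _ oU) /(_ 0 j) := Ck_on_derive (delta_mx 0 i) Cf.
apply: Ck_on_near => // x Ux.
have df : differentiable f x by exact: C1_differentiable oU Ux C1.
by rewrite -(row_jacobian _ df) mxE.
Qed.

End Composition.

(** * Flat functions *)

Section Flat.
Variable R : realType.

(* [flat 0] is the classical smooth function [exp (- 1/x)], extended by 0; the
   family is closed under derivatives up to linear combinations. *)
Definition flat (n : nat) (x : R) : R :=
  if 0 < x then x^-1 ^+ n * expR (- x^-1) else 0.

Lemma flat_ge0 n x : 0 <= flat n x.
Proof.
rewrite /flat; case: ifPn => // x0.
by rewrite mulr_ge0 ?expR_ge0// exprn_ge0// invr_ge0 ltW.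
Qed.

Lemma flat_gt0 n x : 0 < x -> 0 < flat n x.
Proof.
by move=> x0; rewrite /flat x0 mulr_gt0 ?expR_gt0// exprn_gt0// invr_gt0.
Qed.

Lemma flat_eq0 n x : x <= 0 -> flat n x = 0.
Proof. by rewrite /flat leNgt => /negbTE ->. Qed.

Lemma flat_le n x : flat n x <= n.+1`!%:R * `|x|.
Proof.
have [x0|x0] := ltP 0 x; last by rewrite flat_eq0// mulr_ge0.
rewrite /flat x0 gtr0_norm// expRN.
rewrite ler_pdivrMr ?expR_gt0//.
have F0 : (0 : R) < n.+1`!%:R by rewrite ltr0n fact_gt0.
have xi : 0 < x^-1 by rewrite invr_gt0.
have := expR_ge1Dxn n (ltW xi); set e := expR _ => le.
have {}le : x^-1 ^+ n.+1 / n.+1`!%:R <= e by apply: le_trans le; rewrite lerDr.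
rewrite ler_pdivrMr// exprS in le.
rewrite -(ler_pM2l xi); apply: le_trans le _.
rewrite [X in _ <= _ * X]mulrAC mulrA [X in _ <= X]mulrC mulrA.
by rewrite mulfV ?gt_eqF// mul1r mulrC.
Qed.

Lemma is_derive_flat n (x : R) :
  is_derive x (1 : R) (flat n) (flat n.+2 x - n%:R * flat n.+1 x).
Proof.
case: (ltgtP x 0) => x0.
- rewrite !flat_eq0 ?(ltW x0)// mulr0 subr0.
  apply: (near_eq_is_derive _ (is_derive_cst (0 : R) x 1)).
  near=> y; rewrite flat_eq0//=; apply: ltW; near: y; exact: lt_nbhsl.
- apply: (@near_eq_is_derive R R R
    (fun y : R => y^-1 ^+ n * expR (- y^-1))).
    near=> y; rewrite /flat ifT//; near: y; exact: lt_nbhsr.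
  rewrite /flat x0.
  have xn0 : x != 0 by rewrite gt_eqF.
  have dV : is_derive x (1 : R) (fun y : R => y^-1) (- (x ^- 2)).
    apply: is_derive_eq (@is_deriveV R id x 1 1 xn0 (is_derive_id _ _)) _.
    by rewrite [_ *: _]mulr1.
  have dN := is_deriveN dV.
  have dE : is_derive x (1 : R) (fun y : R => expR (- y^-1)) (expR (- x^-1) * x ^- 2).
    by apply: is_derive_eq (is_derive1_comp (is_derive_expR _) dN) _; rewrite opprK.
  have dX : is_derive x (1 : R) (fun y : R => y^-1 ^+ n)
      ((n%:R * x^-1 ^+ n.-1) *: - x ^- 2).
    have -> : (fun y : R => y^-1 ^+ n) = (fun y : R => y^-1) ^+ n.
      by apply/funext => y; rewrite exprfctE.
    exact: (@is_deriveX R R (fun y : R => y^-1) n x 1 _ dV).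
  apply: is_derive_eq (is_deriveM dX dE) _.
  have -> : x ^- 2 = x^-1 * x^-1 by rewrite expr2 invfM.
  rewrite /GRing.scale /=; move: x^-1 (expR _) => y z.
  case: n {dX} => [|n]; first by rewrite !exprS expr0; ring.
  by rewrite /= !exprS; ring.
- rewrite x0 !flat_eq0// mulr0 subr0.
  have L : (fun h : R =>
      h^-1 *: ((flat n \o shift 0) (h *: (1 : R)) - flat n 0)) @ 0^' --> (0 : R).
    apply/cvgrPdist_le => e e0.
    have F0 : (0 : R) < n.+2`!%:R by rewrite ltr0n fact_gt0.
    near=> h; rewrite sub0r normrN /= [h *: 1]mulr1 addr0 (flat_eq0 _ (lexx 0)) subr0.
    have h0 : h != 0 by near: h; exact: nbhs_dnbhs_neq.
    (* The difference quotient at 0 is again a member of the family, so [flat_le] shows that it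
       tends to 0. *)
    have -> : h^-1 *: flat n h = flat n.+1 h.
      by rewrite /flat; case: ifP => _; rewrite ?scaler0// /GRing.scale /= mulrA -exprS.
    rewrite ger0_norm ?flat_ge0//; apply: le_trans (flat_le _ _) _.
    rewrite mulrC -ler_pdivlMr//.
    near: h; apply: dnbhs0_le; exact: divr_gt0.
  split; first by apply/cvg_ex; exists 0.
  exact: cvg_lim L.
Unshelve. all: by end_near. Qed.

Lemma is_derive_comp_scalar (V : normedModType R) (g : R -> R) (f : V -> R) x v dg :
  derivable f x v -> is_derive (f x) (1 : R) g dg ->
  is_derive x v (g \o f) (dg * 'D_v f x).
Proof.
move=> df dgx; have df0 : derivable f (x + (0 : R) *: v) v by rewrite scale0r addr0.
have l0 := is_derive_line df0.
have E : (fun h : R => h^-1 *: (((g \o f) \o shift x) (h *: v) - (g \o f) x)) =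
  (fun h : R => h^-1 *: (((g \o (fun s : R => f (x + s *: v))) \o shift 0)
     (h *: (1 : R)) - (g \o (fun s : R => f (x + s *: v))) 0)).
  apply/funext => h /=; congr (_ *: (g (f _) - g (f _))).
    by rewrite [h *: 1]mulr1 addr0 addrC.
  by rewrite scale0r addr0.
have dg0 : is_derive (f (x + (0 : R) *: v)) 1 g dg by rewrite scale0r addr0.
have [d1 d2] := is_derive1_comp dg0 l0.
rewrite scale0r addr0 in d2.
by split; [rewrite /derivable E|rewrite /derive E].
Qed.

(** The induction on [k] treats all [n] at once, since the derivative of [flat n] involves
    [flat n.+1] and [flat n.+2]. *)
Lemma Ck_on_flat (V : normedModType R) k n (U : set V) (f : V -> R) :
  open U -> Ck_on k U f -> Ck_on k U (flat n \o f).
Proof.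
move=> oU; elim: k n f => [|k IH] n f Cf.
all: have cflat x : U x -> {for x, continuous (flat n \o f)} by
  move=> Ux; apply: continuous_comp (Ck_on_continuous Cf Ux) _;
  apply/differentiable_continuous/derivable1_diffP; case: (is_derive_flat n (f x)).
  by split.
split=> // v.
have dx x : U x -> is_derive x v (flat n \o f)
    ((flat n.+2 (f x) - n%:R * flat n.+1 (f x)) * 'D_v f x).
  move=> Ux.
  exact: is_derive_comp_scalar (Ck_on_derivable Cf Ux) (is_derive_flat _ _).
split=> [x /dx[]//|].
have Ck : Ck_on k U (fun x =>
    ((flat n.+2 \o f) x + - n%:R * (flat n.+1 \o f) x) * 'D_v f x).
  apply: Ck_onM => //; last exact: Ck_on_derive.
  apply: Ck_onD => //; first exact: IH (Ck_onS Cf).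
  apply: Ck_onM => //; first exact: Ck_on_cst.
  exact: IH (Ck_onS Cf).
apply: Ck_on_near Ck => // x Ux.
by have [_ ->] := dx x Ux; rewrite /= mulNr.
Qed.

End Flat.

(** * Lorentzian forms *)

Section QuadraticForms.
Variables (R : realType) (n : nat).
Implicit Types (G : 'M[R]_n) (v w : 'rV[R]_n) (a s : 'cV[R]_n).

Definition coval v a : R := (v *m a) 0 0.

Lemma coval0 a : coval 0 a = 0. Proof. by rewrite /coval mul0mx mxE. Qed.
Lemma covalD v w a : coval (v + w) a = coval v a + coval w a.
Proof. by rewrite /coval mulmxDl mxE. Qed.
Lemma covalZ c v a : coval (c *: v) a = c * coval v a.
Proof. by rewrite /coval -scalemxAl mxE. Qed.
Lemma covalN v a : coval (- v) a = - coval v a.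
Proof. by rewrite /coval mulNmx mxE. Qed.

Lemma coval_continuous a : continuous (fun v => coval v a).
Proof.
move=> v; have -> : (fun v => coval v a) = \sum_j (fun v : 'rV[R]_n => v 0 j * a j 0).
  by apply/funext => u; rewrite /coval mxE fct_sumE.
apply: differentiable_continuous; apply: differentiable_sum => j.
by apply: differentiableM => //; exact: differentiable_coord.
Qed.

Lemma bilinDl G v v' w : bilin G (v + v') w = bilin G v w + bilin G v' w.
Proof. by rewrite /bilin !mulmxDl mxE. Qed.
Lemma bilinDr G v w w' : bilin G v (w + w') = bilin G v w + bilin G v w'.
Proof. by rewrite /bilin linearD mulmxDr mxE. Qed.
Lemma bilinZl G c v w : bilin G (c *: v) w = c * bilin G v w.
Proof. by rewrite /bilin -!scalemxAl mxE. Qed.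
Lemma bilinZr G c v w : bilin G v (c *: w) = c * bilin G v w.
Proof. by rewrite /bilin linearZ /= -scalemxAr mxE. Qed.
Lemma bilinNl G v w : bilin G (- v) w = - bilin G v w.
Proof. by rewrite -scaleN1r bilinZl mulN1r. Qed.
Lemma bilinNr G v w : bilin G v (- w) = - bilin G v w.
Proof. by rewrite -scaleN1r bilinZr mulN1r. Qed.
Lemma bilin0l G w : bilin G 0 w = 0.
Proof. by rewrite /bilin !mul0mx mxE. Qed.

Lemma bilinC G v w : G^T = G -> bilin G v w = bilin G w v.
Proof.
move=> sG; rewrite /bilin -[v *m G *m w^T]trmxK mxE !trmx_mul trmxK sG.
by rewrite mulmxA.
Qed.

Definition bilinE := (bilinDl, bilinDr, bilinZl, bilinZr, bilinNl, bilinNr).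

Lemma bilin_sub_square G s v w :
  bilin (G - s *m s^T) v w = bilin G v w - coval v s * coval w s.
Proof.
rewrite /bilin /coval mulmxBr mulmxBl [LHS]mxE; congr (_ + _).
rewrite mxE; congr (- _); rewrite mulmxA -mulmxA -trmx_mul.
by rewrite mxE big_ord1 [X in _ * X]mxE.
Qed.

(* On [ker s] the form is unchanged, so that a negative definite subspace of
   dimension 2 for the perturbed form would contain a timelike vector of [G]
   annihilated by [s]. *)
Lemma sub_square_index G s : G^T = G -> has_index G 1 ->
  (forall v, Defs.kernel G v -> coval v s = 0) ->
  (forall v, ~ Defs.kernel G v -> bilin G v v <= 0 -> coval v s != 0) ->
  has_index (G - s *m s^T) 1 /\ Defs.kernel (G - s *m s^T) = Defs.kernel G.
Proof.
move=> sG [[T Tneg rT] _] sK sC.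
have neg_s v : bilin G v v < 0 -> coval v s != 0.
  move=> vneg; apply: sC (ltW vneg) => /(_ v) v0.
  by rewrite v0 ltxx in vneg.
split; last first.
  apply/seteqP; split=> v Kv; last first.
    by move=> w; rewrite bilin_sub_square Kv sK // mul0r subrr.
  have E w : bilin G v w = coval v s * coval w s.
    by apply/eqP; rewrite -subr_eq0 -bilin_sub_square Kv.
  have [v0 w|v0] := eqVneq (coval v s) 0; first by rewrite E v0 mul0r.
  have /rowV0Pn[t tT t0] : T != 0 by rewrite -mxrank_eq0 rT.
  have tneg := Tneg t tT t0.
  (* The vector [u] is [t] corrected along [v] so that [s] annihilates it; then [bilin G u u] is
     [bilin G t t - coval t s ^+ 2], still negative. *)
  pose l := coval t s / coval v s.
  pose u := t - l *: v.
  have su : coval u s = 0 by rewrite covalD covalN covalZ divfK ?subrr.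
  suff /neg_s : bilin G u u < 0 by rewrite su eqxx.
  rewrite !bilinE (bilinC t v sG) !E -/l.
  have -> : coval t s = l * coval v s by rewrite divfK.
  have := sqr_ge0 (l * coval v s); lra.
split.
  exists T => // v vT v0; rewrite bilin_sub_square.
  by apply: le_lt_trans (Tneg v vT v0); rewrite gerBl -expr2 sqr_ge0.
move=> W Wneg; rewrite leqNgt; apply/negP => rW.
have : (W :&: kermx s)%MS != 0.
  rewrite -mxrank_eq0 -lt0n.
  have := mxrank_sum_cap W (kermx s); rewrite mxrank_ker => E.
  have := rank_leq_col s; have := rank_leq_col (W + kermx s)%MS.
  have := rank_leq_row s.
  move: rW E; move: (\rank s) (\rank (W + _)%MS) (\rank (W :&: _)%MS) (\rank W).
  by move=> x y z t; lia.
move=> /rowV0Pn[v]; rewrite sub_capmx => /andP[vW /sub_kermxP vs] v0.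
have sv : coval v s = 0 by rewrite /coval vs mxE.
have := Wneg v vW v0; rewrite bilin_sub_square sv mul0r subr0.
by move/neg_s; rewrite sv eqxx.
Qed.

(** Let [t] be timelike and [c = bilin G t t]. Adding the square of
    [a = sqrt (2 / - c) * bilin G _ t] changes the value [x ^+ 2 * c] on [x *: t] into
    [x ^+ 2 * - c] and leaves the form unchanged on the orthogonal complement of [t], where it is
    positive. *)
Lemma lorentz_pos G : G^T = G -> has_index G 1 -> Defs.kernel G = [set 0] ->
  exists a, forall v, v != 0 -> 0 < bilin G v v + coval v a ^+ 2.
Proof.
move=> sG [[T Tneg rT] Tmax] kG.
have /rowV0Pn[t tT t0] : T != 0 by rewrite -mxrank_eq0 rT.
have tneg := Tneg t tT t0; set c := bilin G t t in tneg.
(* A timelike [w] orthogonal to [t] would span with [t] a negative definite plane. *)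
have perp2 w : bilin G w t = 0 -> 0 <= bilin G w w.
  move=> wt; rewrite leNgt; apply/negP => wneg.
  have w0 : w != 0 by apply/eqP => w0; rewrite w0 bilin0l ltxx in wneg.
  have tw : bilin G t w = 0 by rewrite bilinC.
  suff : (\rank (t + w)%MS <= 1)%N.
    have := mxrank_sum_cap t w; rewrite !rank_rV t0 w0 /= => E rk.
    suff cap0 : \rank (t :&: w)%MS = 0%N by move: E rk; rewrite cap0 addn0 => ->.
    apply/eqP; rewrite mxrank_eq0; apply/negP => /negP/rowV0Pn[v].
    rewrite sub_capmx => /andP[/sub_rVP[x ->] /sub_rVP[y xy]].
    move=> /negP; apply; suff -> : x = 0 by rewrite scale0r.
    apply/eqP; have : x * c = 0 by rewrite -bilinZl xy bilinZl wt mulr0.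
    by move/eqP; rewrite mulf_eq0 (lt_eqF tneg) orbF.
  apply: Tmax => v /sub_addsmxP[[p r] /= ->].
  rewrite (mx11_scalar p) (mx11_scalar r) !mul_scalar_mx.
  move: (p 0 0) (r 0 0) => x y xy0.
  have -> : bilin G (x *: t + y *: w) (x *: t + y *: w) =
      x ^+ 2 * c + y ^+ 2 * bilin G w w by rewrite !bilinE wt tw -/c; ring.
  have [x0|x0] := eqVneq x 0.
    have y0 : y != 0.
      by apply: contraNneq xy0 => ->; rewrite x0 !scale0r addr0.
    rewrite x0 expr0n /= mul0r add0r pmulr_rlt0 //.
    by rewrite lt0r sqrf_eq0 y0 sqr_ge0.
  have := sqr_ge0 y => y2.
  apply: (@lt_le_trans _ _ (0 + y ^+ 2 * 0)); last by rewrite mulr0 addr0.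
  apply: ltr_leD; last by rewrite ler_wpM2l// ltW.
  by rewrite pmulr_rlt0 // lt0r sqrf_eq0 x0 sqr_ge0.
have pos w : bilin G w t = 0 -> w != 0 -> 0 < bilin G w w.
  move=> wt w0; rewrite lt_def perp2 // andbT; apply/eqP => ww.
  have : ~ Defs.kernel G w by rewrite kG => /eqP; rewrite (negbTE w0).
  apply => u; apply/eqP; apply: contraT => wu.
  pose u' := u - (bilin G u t / c) *: t.
  have ut : bilin G u' t = 0.
    by rewrite !bilinE -/c divfK ?subrr// lt_eqF.
  have wu' : bilin G w u' = bilin G w u by rewrite !bilinE wt mulr0 subr0.
  (* For null [w], the form at [u' + r *: w] is affine in [r]; this [r] gives the value -1, on a
     vector orthogonal to [t]. *)
  clearbody u'; pose r := - (bilin G u' u' + 1) / (2 * bilin G w u).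
  have ur : bilin G (u' + r *: w) t = 0 by rewrite !bilinE ut wt mulr0 addr0.
  have := perp2 _ ur; suff -> : bilin G (u' + r *: w) (u' + r *: w) = -1.
    by rewrite lerNr oppr0 ler10.
  by rewrite !bilinE ww (bilinC u' w sG) wu' /r; field.
exists (Num.sqrt (2 / - c) *: (G *m t^T)) => v v0.
have nc : 0 < - c by rewrite oppr_gt0.
have -> : coval v (Num.sqrt (2 / - c) *: (G *m t^T)) = Num.sqrt (2 / - c) * bilin G v t.
  by rewrite /coval -scalemxAr mulmxA mxE.
rewrite exprMn sqr_sqrtr; last by rewrite divr_ge0// ltW.
pose x := bilin G v t / c; pose w := v - x *: t.
have c0 : c != 0 by rewrite lt_eqF.
have vE : v = x *: t + w by rewrite addrC subrK.
have wt : bilin G w t = 0 by rewrite !bilinE -/c divfK ?subrr.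
have tw : bilin G t w = 0 by rewrite bilinC.
clearbody w; have -> : bilin G v t = x * c by rewrite divfK.
have -> : bilin G v v = x ^+ 2 * c + bilin G w w.
  by rewrite [in LHS]vE !bilinE wt tw -/c; ring.
have -> : x ^+ 2 * c + bilin G w w + 2 / - c * (x * c) ^+ 2 =
    x ^+ 2 * - c + bilin G w w.
  by field.
have [w0|w0] := eqVneq w 0.
  have x0 : x != 0 by apply: contraNneq v0 => x0; rewrite vE w0 x0 scale0r addr0.
  by rewrite w0 bilin0l addr0 mulr_gt0 // lt0r sqrf_eq0 x0 sqr_ge0.
by apply: ltr_wpDl (pos w wt w0); rewrite mulr_ge0 ?sqr_ge0 // ltW.
Qed.

Lemma bilin_norm_le G v : `|bilin G v v| <= (n * n)%:R * `|G| * `|v| ^+ 2.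
Proof.
rewrite /bilin mxE; apply: le_trans (ler_norm_sum _ _ _) _.
apply: (@le_trans _ _ (\sum_(i < n) n%:R * `|G| * `|v| ^+ 2)).
  apply: ler_sum => i _; rewrite !mxE normrM expr2 mulrA.
  apply: ler_pM => //; last exact: mx_entry_le.
  apply: le_trans (ler_norm_sum _ _ _) _.
  apply: (@le_trans _ _ (\sum_(j < n) `|v| * `|G|)).
    by apply: ler_sum => j _; rewrite normrM ler_pM // mx_entry_le.
  by rewrite sumr_const card_ord -[_ *+ _]mulr_natl mulrAC mulrA.
by rewrite sumr_const card_ord -[_ *+ _]mulr_natl natrM !mulrA.
Qed.

Lemma bilin_continuous G : continuous (fun v => bilin G v v).
Proof.
move=> v.
have C0 := @Ck_on_id R 'rV[R]_n 0 setT.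
have C1 := Ck_on_mulmx openT (Ck_on_mulmx openT C0 (Ck_on_cst 0 setT G))
  (Ck_on_trmx openT C0).
have /(Ck_on_mxP _ _ openT) /(_ 0 0) C2 := C1.
exact: Ck_on_continuous C2 I.
Qed.

Lemma lorentz_bound G : G^T = G -> has_index G 1 -> Defs.kernel G = [set 0] ->
  exists a, exists2 l : R, 0 < l &
    forall v, l * `|v| ^+ 2 <= bilin G v v + coval v a ^+ 2.
Proof.
move=> sG iG kG; have [a apos] := lorentz_pos sG iG kG; exists a.
pose Q v := bilin G v v + coval v a ^+ 2.
have QZ x v : Q (x *: v) = x ^+ 2 * Q v.
  by rewrite /Q !bilinE covalZ; ring.
have cQ : continuous Q.
  move=> v; have c2 := continuousM (@coval_continuous a v) (@coval_continuous a v).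
  exact: continuousD (@bilin_continuous G v) c2.
pose S := [set v : 'rV[R]_n | `|v| = 1].
(* The unit sphere is empty only if 0 is the only vector, and then any [l] works. Otherwise [l] is
   the minimum of [Q] on the sphere. *)
have [S0|S0] := pselect (S !=set0); last first.
  exists 1 => // v; suff -> : v = 0.
    by rewrite normr0 expr0n mulr0 bilin0l coval0 add0r expr0n.
  apply/eqP; apply: contrapT => /negP v0; apply: S0; exists (`|v|^-1 *: v).
  by rewrite /S /= normrZ normfV normr_id mulVf // normr_eq0.
have cS : compact S.
  apply: bounded_closed_compact.
    exists 1; split; first exact: num_real.
    by move=> x x1 v; rewrite /S /= => ->; exact: ltW.
  have -> : S = (fun v : 'rV[R]_n => `|v|) @^-1` [set 1] by [].
  by apply: closed_comp => [v _|]; [exact: norm_continuous|exact: closed_eq].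
have [c /set_mem Sc cmin] := EVT_min_rV S0 cS (continuous_subspaceT cQ).
exists (Q c).
  by apply: apos; rewrite -normr_gt0 Sc.
move=> v; have [->|v0] := eqVneq v 0.
  by rewrite normr0 expr0n mulr0 bilin0l coval0 add0r expr0n.
have nv : 0 < `|v| by rewrite normr_gt0.
have : Q c <= Q (`|v|^-1 *: v).
  by apply: cmin; rewrite inE /S /= normrZ normfV normr_id mulVf // gt_eqF.
rewrite QZ -/(Q v) exprVn [X in _ <= X]mulrC ler_pdivlMr //.
exact: exprn_gt0.
Qed.

(** On [ker a] the form [G] is at least [l * |v|^2], and passing to [G'] changes it by less than
    that for [v != 0]; so nonzero vectors of [ker a] remain spacelike. The successor in [d] covers
    [n = 0]. *)
Lemma lorentz_pos_open G a l : 0 < l ->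
  (forall v, l * `|v| ^+ 2 <= bilin G v v + coval v a ^+ 2) ->
  exists2 d : R, 0 < d & forall G', `|G' - G| < d ->
    forall v, v != 0 -> bilin G' v v <= 0 -> coval v a != 0.
Proof.
move=> l0 lb; pose d := l / (n * n).+1%:R.
have d0 : 0 < d by rewrite divr_gt0.
exists d => // G' G'd v v0 G'v; apply/eqP => va.
have := lb v; rewrite va expr0n /= addr0.
have -> : bilin G v v = bilin G' v v - bilin (G' - G) v v.
  have -> : bilin (G' - G) v v = bilin G' v v - bilin G v v.
    by rewrite /bilin mulmxBr mulmxBl mxE [X in _ + X]mxE.
  by rewrite opprB addrC subrK.
have := bilin_norm_le (G' - G) v; rewrite ler_norml => /andP[lo _] le.
have nv : 0 < `|v| ^+ 2 by rewrite exprn_gt0 // normr_gt0.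
have : l * `|v| ^+ 2 <= (n * n)%:R * `|G' - G| * `|v| ^+ 2 by lra.
rewrite ler_pM2r // leNgt => /negP; apply.
apply: (@le_lt_trans _ _ ((n * n)%:R * d)); first by rewrite ler_wpM2l // ltW.
by rewrite /d mulrCA gtr_pMr // ltr_pdivrMr // mul1r ltr_nat.
Qed.

Definition nonspacelike G : set 'rV[R]_n := causal_vectors [set 0] G.

Lemma nonspacelikeE G v : nonspacelike G v <-> v != 0 /\ bilin G v v <= 0.
Proof.
split=> [[v0 Gv]|[v0 Gv]]; split=> //; first by apply/eqP.
exact/eqP.
Qed.

Lemma nonspacelikeN G v : nonspacelike G v -> nonspacelike G (- v).
Proof.
move=> /nonspacelikeE[v0 Gv]; apply/nonspacelikeE.
by rewrite oppr_eq0 bilinNl bilinNr opprK.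
Qed.

(** Equivalently, [G] is positive definite on [ker a]. The condition does not distinguish [a] from
    [- a]; time orientation enters separately. *)
Definition causal_coval G a := forall v, nonspacelike G v -> coval v a != 0.

(* Otherwise [coval v a *: u - coval u a *: v] would be timelike and
   annihilated by [a]. *)
Lemma same_side_bilin_le0 G a u v : G^T = G -> causal_coval G a ->
  nonspacelike G u -> nonspacelike G v -> 0 < coval u a -> 0 < coval v a ->
  bilin G u v <= 0.
Proof.
move=> sG aG /nonspacelikeE[u0 Gu] /nonspacelikeE[v0 Gv] ua va.
rewrite leNgt; apply/negP => uv.
pose y := coval v a *: u - coval u a *: v.
have ya : coval y a = 0 by rewrite /y covalD covalN !covalZ; ring.
have Gy : bilin G y y < 0.
  rewrite /y !bilinE (bilinC v u sG).
  have h1 : coval v a ^+ 2 * bilin G u u <= 0 by rewrite mulr_ge0_le0 // sqr_ge0.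
  have h2 : coval u a ^+ 2 * bilin G v v <= 0 by rewrite mulr_ge0_le0 // sqr_ge0.
  have h3 : 0 < coval v a * coval u a * bilin G u v by rewrite !mulr_gt0.
  rewrite !expr2 in h1 h2; lra.
suff /aG : nonspacelike G y by rewrite ya eqxx.
apply/nonspacelikeE; split; last exact: ltW.
by apply/eqP => y0; rewrite y0 bilin0l ltxx in Gy.
Qed.

(** The segment from [u] to [v] consists of causal vectors: the cross term is nonpositive, and [a]
    is positive along it, so it avoids 0. *)
Lemma same_side_component G a u v : G^T = G -> causal_coval G a ->
  nonspacelike G u -> nonspacelike G v -> 0 < coval u a -> 0 < coval v a ->
  connected_component (nonspacelike G) u v.
Proof.
move=> sG aG Cu Cv ua va.
have uv := same_side_bilin_le0 sG aG Cu Cv ua va.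
have [/nonspacelikeE[_ Gu] /nonspacelikeE[_ Gv]] := (Cu, Cv).
pose f (t : R) := u + t *: (v - u).
exists (f @` `[0, 1]%classic); last first.
  by exists 1; rewrite /= ?in_itv /= ?ler01 ?lexx // /f scale1r addrC subrK.
split.
- by exists 0; rewrite /= ?in_itv /= ?ler01 ?lexx // /f scale0r addr0.
- move=> _ [t /= t01 <-]; rewrite in_itv /= in t01; have /andP[t0 t1] := t01.
  have fE : f t = (1 - t) *: u + t *: v.
    by rewrite /f scalerBl scale1r scalerBr addrAC addrA.
  have s0 : 0 <= 1 - t by rewrite subr_ge0.
  apply/nonspacelikeE; split.
    suff : coval (f t) a != 0 by apply: contraNneq => ->; rewrite coval0.
    rewrite fE covalD !covalZ gt_eqF //.
    have [->|tn0] := eqVneq t 0; first by rewrite mul0r addr0 subr0 mul1r.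
    apply: ltr_wpDl; first by rewrite mulr_ge0 // ltW.
    by rewrite mulr_gt0 // lt_def tn0.
  rewrite fE !bilinE (bilinC v u sG).
  have h1 : (1 - t) * ((1 - t) * bilin G u u) <= 0 by do 2 rewrite mulr_ge0_le0 //.
  have h2 : t * (t * bilin G v v) <= 0 by do 2 rewrite mulr_ge0_le0 //.
  have h3 : t * ((1 - t) * bilin G u v) <= 0 by do 2 rewrite mulr_ge0_le0 //.
  by move: h1 h2 h3; rewrite (mulrCA (1 - t) t); lra.
- apply: connected_continuous_connected.
    exact: (connected_intervalP _).2 (@interval_is_interval _ `[0, 1]).
  apply: continuous_subspaceT => t.
  exact: continuousD (@cst_continuous _ _ u t) (@scalel_continuous _ _ (v - u) t).
Qed.

Lemma component_same_side G a u v : causal_coval G a ->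
  connected_component (nonspacelike G) u v -> 0 < coval u a -> 0 < coval v a.
Proof.
move=> aG [A [Au AG cA] Av] ua.
have : is_interval ((fun v => coval v a) @` A).
  apply/connected_intervalP; apply: connected_continuous_connected cA _.
  exact: continuous_subspaceT (@coval_continuous a).
move=> itvA; rewrite ltNge; apply/negP => va.
have [w /AG/aG + w0] : ((fun v => coval v a) @` A) 0.
  by apply: (itvA (coval v a) (coval u a)); [exists v|exists u|rewrite va ltW].
by rewrite w0 eqxx.
Qed.

(** The vectors [u] and [w] witness that [a] and [b] are positive on the cone [Fut]. Positivity of
    [a] at [v] puts [v] into this cone, where [b] keeps its sign. *)
Lemma future_coval_sign G a b v0 u w v : G^T = G ->
  causal_coval G a -> causal_coval G b ->
  let Fut := connected_component (nonspacelike G) v0 in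
  Fut u -> 0 < coval u a -> Fut w -> 0 < coval w b ->
  nonspacelike G v -> 0 < coval v a -> 0 < coval v b.
Proof.
move=> sG aG bG Fut Fu ua Fw wb Cv va.
have Cu : nonspacelike G u by case: Fu => A [_ AG _] /AG.
have uv := same_side_component sG aG Cu Cv ua va.
apply: component_same_side bG _ wb.
apply: connected_component_trans uv.
apply: connected_component_trans Fu.
exact: connected_component_sym.
Qed.

End QuadraticForms.

(** * Charts and smooth maps *)

Lemma derive_entry (R : realType) (V : normedModType R) m n
    (A : V -> 'M[R]_(m, n)) x v i j : derivable A x v ->
  ('D_v A x) i j = 'D_v (fun y => A y i j) x.
Proof. by move=> dA; rewrite (derive_mx dA) mxE. Qed.

Section ChartCalculus.
Variables (R : realType) (n : nat) (M : manifold R n).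
Implicit Types (c d : chart R M n) (x y : M).

Lemma open_chart_preimage (T : topologicalType) k (c : chart R T k) (D : set T) :
  open D -> open (cod c `&` bwd c @^-1` D).
Proof.
move=> oD; rewrite openE => p [cp Dp]; apply: filterI.
  by apply: open_nbhs_nbhs; split=> //; exact: cod_open.
by apply: (bwd_continuous cp); exact: open_nbhs_nbhs.
Qed.

Lemma transition_smooth c d : atlas c -> atlas d ->
  smooth_on (cod c `&` bwd c @^-1` dom d) (d \o bwd c).
Proof. by move=> ac ad; have [] := atlas_compatible ac ad. Qed.

Lemma smooth_on_differentiable k m p (U : set 'rV[R]_k)
    (f : 'rV[R]_k -> 'M[R]_(m, p)) q :
  open U -> smooth_on U f -> U q -> differentiable f q.
Proof. by move=> oU sf Uq; exact: C1_differentiable oU Uq (sf 1%N). Qed.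

Lemma transition_differentiable c d x : atlas c -> atlas d -> dom c x -> dom d x ->
  differentiable (d \o bwd c) (c x).
Proof.
move=> ac ad cx dx.
apply: (smooth_on_differentiable _ (transition_smooth ac ad)).
  exact/open_chart_preimage/dom_open.
by split; [exact: fwd_cod|rewrite /= fwdK].
Qed.

Lemma chart_nbhs c x (D : set M) : open D -> dom c x -> D x ->
  \forall p \near c x, cod c p /\ D (bwd c p).
Proof.
move=> oD cx Dx; have := @open_chart_preimage _ _ c _ oD; rewrite openE; apply.
by split; [exact: fwd_cod|rewrite /= fwdK].
Qed.

Lemma jacobian_change m c d x (f : M -> 'rV[R]_m) : atlas c -> atlas d ->
  dom c x -> dom d x -> differentiable (f \o bwd d) (d x) ->
  differentiable (f \o bwd c) (c x) ->
  'J (f \o bwd c) (c x) = 'J (d \o bwd c) (c x) *m 'J (f \o bwd d) (d x).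
Proof.
move=> ac ad cx dx dfd dfc.
have dcd := transition_differentiable ac ad cx dx.
have E : (d \o bwd c) (c x) = d x by rewrite /= fwdK.
rewrite -[in RHS]E; rewrite -[in X in differentiable _ X]E in dfd.
rewrite -(jacobian_comp dcd dfd).
apply: (jacobian_near dfc (differentiable_comp dcd dfd)).
apply: filterS (chart_nbhs (dom_open d) cx dx) => p [cp dp] /=.
by rewrite fwdK.
Qed.

Lemma transition_jacobian c d x : atlas c -> atlas d -> dom c x -> dom d x ->
  'J (d \o bwd c) (c x) = of_chart c x *m to_chart d x.
Proof.
move=> ac ad cx dx; apply: jacobian_change => //.
- exact: chart_at_atlas.
- exact: chart_at_dom.
- apply: transition_differentiable => //; first exact: chart_at_atlas.
  exact: chart_at_dom.
- exact: transition_differentiable.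
Qed.

Lemma transition_jacobian_id c x : atlas c -> dom c x ->
  'J (c \o bwd c) (c x) = 1%:M.
Proof.
move=> ac cx; rewrite -(jacobian_id (c x)).
have did : differentiable (@id 'rV[R]_n) (c x) by apply: ex_diff.
apply: (jacobian_near (transition_differentiable ac ac cx cx) did).
by apply: filterS (chart_nbhs openT cx I) => p [cp _] /=; rewrite bwdK.
Qed.

Lemma of_to_chart c x : atlas c -> dom c x -> of_chart c x *m to_chart c x = 1%:M.
Proof. by move=> ac cx; rewrite -transition_jacobian // transition_jacobian_id. Qed.

Lemma to_of_chart c x : atlas c -> dom c x -> to_chart c x *m of_chart c x = 1%:M.
Proof. by move=> ac cx; apply: mulmx1C; exact: of_to_chart. Qed.

(* A covector field [a] is given by its components in the preferred charts. *)
Definition covector_in (c : chart R M n) (a : M -> 'cV[R]_n) (p : 'rV[R]_n)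
    : 'cV[R]_n :=
  of_chart c (bwd c p) *m a (bwd c p).

Definition smooth_covector (a : M -> 'cV[R]_n) : Prop :=
  forall c, atlas c -> smooth_on (cod c) (covector_in c a).

Definition smooth_fun (f : M -> R) : Prop :=
  forall c, atlas c -> smooth_on (cod c) (f \o bwd c).

Lemma smooth_covector_sum (I : Type) (r : seq I) (a : I -> M -> 'cV[R]_n) :
  (forall i, smooth_covector (a i)) ->
  smooth_covector (fun x => \sum_(i <- r) a i x).
Proof.
move=> sa c ac k.
have -> : covector_in c (fun x => \sum_(i <- r) a i x) =
    (fun p => \sum_(i <- r) covector_in c (a i) p).
  by apply/funext => p; rewrite /covector_in mulmx_sumr.
by apply: Ck_on_sum => [|i _]; [exact: cod_open|exact: sa].
Qed.

Lemma smooth_covectorZ (f : M -> R) (a : M -> 'cV[R]_n) :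
  smooth_fun f -> smooth_covector a -> smooth_covector (fun x => f x *: a x).
Proof.
move=> sf sa c ac k.
have -> : covector_in c (fun x => f x *: a x) =
    (fun p => (f \o bwd c) p *: covector_in c a p).
  by apply/funext => p; rewrite /covector_in -scalemxAr.
by apply: Ck_onZ; [exact: cod_open|exact: sf|exact: sa].
Qed.

Lemma smooth_covector_local (a : M -> 'cV[R]_n) :
  (forall x, exists D a', [/\ open D, D x, smooth_covector a' &
    forall y, D y -> a' y = a y]) -> smooth_covector a.
Proof.
move=> loc c ac; apply: smooth_on_local => p cp.
have [D [a' [oD Dx sa' aa']]] := loc (bwd c p).
exists (cod c `&` bwd c @^-1` D), (covector_in c a'); split=> //.
- exact: open_chart_preimage.
- by apply: smooth_onW (sa' c ac) => q [].
- by move=> q [_ Dq]; rewrite /covector_in aa'.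
Qed.

Lemma smooth_fun_flat (f : M -> R) k : smooth_fun f -> smooth_fun (flat k \o f).
Proof. by move=> sf c ac l; apply: Ck_on_flat; [exact: cod_open|exact: sf]. Qed.

Lemma smooth_fun_cst (a : R) : smooth_fun (fun=> a).
Proof. by move=> c ac l; exact: Ck_on_cst. Qed.

Lemma smooth_funD (f g : M -> R) : smooth_fun f -> smooth_fun g ->
  smooth_fun (fun x => f x + g x).
Proof.
by move=> sf sg c ac l; apply: Ck_onD; [exact: cod_open|exact: sf|exact: sg].
Qed.

Lemma smooth_funM (f g : M -> R) : smooth_fun f -> smooth_fun g ->
  smooth_fun (fun x => f x * g x).
Proof.
by move=> sf sg c ac l; apply: Ck_onM; [exact: cod_open|exact: sf|exact: sg].
Qed.

Lemma smooth_fun_prod (I : Type) (r : seq I) (f : I -> M -> R) :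
  (forall i, smooth_fun (f i)) -> smooth_fun (fun x => \prod_(i <- r) f i x).
Proof.
move=> sf; elim: r => [|i r IH].
  have -> : (fun x => \prod_(i <- [::]) f i x) = (fun=> 1).
    by apply/funext => x; rewrite big_nil.
  exact: smooth_fun_cst.
have -> : (fun x => \prod_(j <- i :: r) f j x) =
    (fun x => f i x * \prod_(j <- r) f j x).
  by apply/funext => x; rewrite big_cons.
exact: smooth_funM.
Qed.

Lemma smooth_fun_continuous (f : M -> R) : smooth_fun f -> continuous f.
Proof.
move=> sf x; have ac := chart_at_atlas x; have cx := chart_at_dom x.
have cf : {for chart_at x x, continuous (f \o bwd (chart_at x))}.
  exact: Ck_on_continuous (sf _ ac 0%N) (fwd_cod cx).
have cv : ((f \o bwd (chart_at x)) \o chart_at x) y @[y --> x] -->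
    ((f \o bwd (chart_at x)) \o chart_at x) x.
  exact: continuous_comp (fwd_continuous cx) cf.
suff : f y @[y --> x] --> ((f \o bwd (chart_at x)) \o chart_at x) x.
  by rewrite /= fwdK.
apply: cvg_trans cv; apply: near_eq_cvg.
have nd : \forall y \near x, dom (chart_at x) y.
  by apply: open_nbhs_nbhs; split=> //; exact: dom_open.
by apply: filterS nd => y dy /=; rewrite fwdK.
Qed.

Lemma covector_in_continuous c (a : M -> 'cV[R]_n) x : atlas c -> dom c x ->
  smooth_covector a -> {for x, continuous (fun y => covector_in c a (c y))}.
Proof.
move=> ac cx sa.
exact: continuous_comp (fwd_continuous cx)
  (Ck_on_continuous (sa c ac 0%N) (fwd_cod cx)).
Qed.

End ChartCalculus.

(** * Pullback of covector fields and its invariance along the fibers *)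

Section Pullback.
Variables (R : realType) (n m : nat) (M : manifold R n) (N : manifold R m).
Variable f : M -> N.
Hypothesis sf : smooth_map f.

Definition covector_pullback (a : N -> 'cV[R]_m) (x : M) : 'cV[R]_n :=
  tangent_map f x *m a (f x).

Let chart_expr (c : chart R M n) (d : chart R N m) := d \o f \o bwd c.

Let expr_dom (c : chart R M n) (d : chart R N m) :=
  cod c `&` bwd c @^-1` (f @^-1` dom d).

Lemma open_expr_dom c d : open (expr_dom c d).
Proof.
apply: open_chart_preimage; apply: open_comp; last exact: dom_open.
by move=> x _; exact: sf.1.
Qed.

Lemma smooth_expr c d : atlas c -> atlas d ->
  smooth_on (expr_dom c d) (chart_expr c d).
Proof. by move=> ac ad; exact: sf.2. Qed.

Lemma expr_differentiable c d x : atlas c -> atlas d -> dom c x -> dom d (f x) ->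
  differentiable (chart_expr c d) (c x).
Proof.
move=> ac ad cx dx.
apply: (smooth_on_differentiable (@open_expr_dom c d) (smooth_expr ac ad)).
by split; [exact: fwd_cod|rewrite /= fwdK].
Qed.

Lemma expr_jacobian c d x : atlas c -> atlas d -> dom c x -> dom d (f x) ->
  'J (chart_expr c d) (c x) =
  of_chart c x *m tangent_map f x *m to_chart d (f x).
Proof.
move=> ac ad cx dx.
have ax := chart_at_atlas x; have axd := chart_at_dom x.
have ay := chart_at_atlas (f x); have ayd := chart_at_dom (f x).
have -> : 'J (chart_expr c d) (c x) =
    of_chart c x *m 'J (chart_expr (chart_at x) d) (chart_at x x).
  by apply: (@jacobian_change _ _ _ _ _ _ _ (d \o f)) => //; exact: expr_differentiable.
rewrite -mulmxA; congr (_ *m _).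
have E : (chart_at (f x) \o f \o bwd (chart_at x)) (chart_at x x) =
    chart_at (f x) (f x).
  by rewrite /= fwdK.
have dd := expr_differentiable ax ay axd ayd.
have dt := transition_differentiable ay ad ayd dx.
rewrite /tangent_map /to_chart -[in X in _ *m X]E; rewrite -E in dt.
rewrite -(jacobian_comp dd dt).
apply: (jacobian_near (expr_differentiable ax ad axd dx) (differentiable_comp dd dt)).
have oD : open (f @^-1` dom (chart_at (f x))).
  by apply: open_comp; [move=> y _; exact: sf.1|exact: dom_open].
apply: filterS (chart_nbhs oD axd ayd) => p [cp dp].
by rewrite /chart_expr /= fwdK.
Qed.

Lemma covector_in_pullback c d (a : N -> 'cV[R]_m) p : atlas c -> atlas d ->
  expr_dom c d p ->
  covector_in c (covector_pullback a) p =
  'J (chart_expr c d) p *m covector_in d a (chart_expr c d p).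
Proof.
move=> ac ad [cp dp]; rewrite -{2}(bwdK cp) expr_jacobian //; last exact: bwd_dom.
rewrite /covector_in /covector_pullback /chart_expr /= fwdK //.
by rewrite -!mulmxA (mulmxA (to_chart d _)) to_of_chart // mul1mx.
Qed.

Lemma smooth_covector_pullback a : smooth_covector a ->
  smooth_covector (covector_pullback a).
Proof.
move=> sa c ac; apply: smooth_on_local => p cp.
pose d := chart_at (f (bwd c p)).
have ad : atlas d by exact: chart_at_atlas.
have dp : expr_dom c d p by split=> //; exact: chart_at_dom.
have oU := @open_expr_dom c d.
exists (expr_dom c d), (fun q => 'J (chart_expr c d) q *m
  covector_in d a (chart_expr c d q)); split=> //.
  move=> k; apply: (Ck_on_mulmx oU (Ck_on_jacobian oU (smooth_expr ac ad k.+1))).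
  apply: (@Ck_on_comp R n m k m 1 _ (cod d) (chart_expr c d) (covector_in d a)) => //.
  - exact: cod_open.
  - by move=> q [_]; exact: fwd_cod.
  - exact: smooth_expr.
  - exact: sa.
by move=> q Uq; rewrite (covector_in_pullback _ ac ad Uq).
Qed.


Lemma smooth_tensor_derivable (g : M -> 'M[R]_n) c p v : smooth_tensor g ->
  atlas c -> cod c p -> derivable (tensor_in c g) p v.
Proof. by move=> sg ac cp; exact: Ck_on_derivable (sg c ac 1%N) cp. Qed.

Lemma tensor_in_sub_square (g : M -> 'M[R]_n) (s : M -> 'cV[R]_n) (c : chart R M n) p :
  tensor_in c (fun x => g x - s x *m (s x)^T) p =
  tensor_in c g p - covector_in c s p *m (covector_in c s p)^T.
Proof.
rewrite /tensor_in /covector_in mulmxBr mulmxBl; congr (_ - _).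
by rewrite trmx_mul !mulmxA.
Qed.

Lemma smooth_tensor_sub_square (g : M -> 'M[R]_n) (s : M -> 'cV[R]_n) :
  smooth_tensor g -> smooth_covector s ->
  smooth_tensor (fun x => g x - s x *m (s x)^T).
Proof.
move=> sg ss c ac k.
have -> : tensor_in c (fun x => g x - s x *m (s x)^T) = (fun p =>
    tensor_in c g p + (-1)%:M *m (covector_in c s p *m (covector_in c s p)^T)).
  by apply/funext => p; rewrite tensor_in_sub_square mul_scalar_mx scaleN1r.
have oc := @cod_open _ _ _ c; apply: Ck_onD => //; first exact: sg.
apply: Ck_on_mulmx => //; first exact: Ck_on_cst.
by apply: Ck_on_mulmx => //; [exact: ss|apply: Ck_on_trmx => //; exact: ss].
Qed.

Section VerticalLie.
Variables (X : M -> 'rV[R]_n) (a : N -> 'cV[R]_m).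
Hypotheses (sX : smooth_vf X) (Xf : forall x, X x *m tangent_map f x = 0).
Hypothesis sa : smooth_covector a.

Lemma vf_expr_jacobian c d q : atlas c -> atlas d -> expr_dom c d q ->
  vf_in c X q *m 'J (chart_expr c d) q = 0.
Proof.
move=> ac ad [cq dq]; rewrite -{2}(bwdK cq) expr_jacobian //; last exact: bwd_dom.
rewrite /vf_in -!mulmxA (mulmxA (to_chart c _)) to_of_chart //; last exact: bwd_dom.
by rewrite mul1mx mulmxA Xf mul0mx.
Qed.

(* The components of [X] annihilate the Jacobian of [f] identically;
   differentiating this and exchanging the second derivatives of [f] shows that
   the Jacobian is Lie constant. *)
Lemma lie_jacobian c d p : atlas c -> atlas d -> expr_dom c d p ->
  'D_(vf_in c X p) (fun q => 'J (chart_expr c d) q) p +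
  'J (vf_in c X) p *m 'J (chart_expr c d) p = 0.
Proof.
move=> ac ad dp; have oU := @open_expr_dom c d.
set P := fun q => 'J (chart_expr c d) q; set v := vf_in c X p.
have sphi := smooth_expr ac ad.
have CP k : Ck_on k (expr_dom c d) P by exact: Ck_on_jacobian oU (sphi k.+1).
have dphi q : expr_dom c d q -> differentiable (chart_expr c d) q.
  by move=> Uq; exact: smooth_on_differentiable oU sphi Uq.
have dP w : derivable P p w by exact: Ck_on_derivable (CP 1%N) dp.
have cp : cod c p by case: dp.
have dX : differentiable (vf_in c X) p.
  exact: smooth_on_differentiable (@cod_open _ _ _ c) (sX ac) cp.
have dXw w : derivable (vf_in c X) p w by exact: diff_derivable.
apply/row_matrixP => i; rewrite linearD linear0 /=.
set e := delta_mx 0 i : 'rV[R]_n.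
have E1 : row i ('D_v P p) = 'D_v ('D_e (chart_expr c d)) p.
  apply/rowP => j; rewrite mxE (derive_entry i j (dP v)).
  have D2 : derivable ('D_e (chart_expr c d)) p v.
    exact: Ck_on_derivable (Ck_on_derive e (sphi 2%N)) dp.
  rewrite (derive_entry 0 j D2); apply: near_eq_derive.
  apply: (near_eq_on _ oU dp) => q Uq.
  by rewrite -(row_jacobian i (dphi q Uq)) [RHS]mxE.
have E2 : row i ('J (vf_in c X) p *m P p) = 'D_e (vf_in c X) p *m P p.
  by rewrite row_mul (row_jacobian i dX).
have E3 : 'D_v ('D_e (chart_expr c d)) p = 'D_e ('D_v (chart_expr c d)) p.
  have D2 u w : derivable ('D_u (chart_expr c d)) p w.
    exact: Ck_on_derivable (Ck_on_derive u (sphi 2%N)) dp.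
  apply/rowP => j.
  have C2 : Ck_on 2 (expr_dom c d) (fun q => chart_expr c d q 0 j).
    exact: ((Ck_on_mxP 2 _ oU).1 (sphi 2%N) 0 j).
  have nE u : {near p, (fun q => 'D_u (chart_expr c d) q 0 j) =1
      'D_u (fun q => chart_expr c d q 0 j)}.
    apply: (near_eq_on _ oU dp) => q Uq.
    by rewrite derive_entry //; exact: diff_derivable (dphi q Uq).
  apply: etrans (derive_entry 0 j (D2 e v)) _.
  apply: etrans (esym (derive_entry 0 j (D2 v e))).
  apply: etrans (near_eq_derive _ (nE e)) _.
  apply: etrans (esym (near_eq_derive _ (nE v))).
  exact: derive_sym oU dp C2.
have E4 : 'D_e ('D_v (chart_expr c d)) p = v *m 'D_e P p.
  have [_ D] := is_derive_mulmx (@derivable_cst _ _ _ v p e) (dP e).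
  rewrite derive_cst mul0mx add0r in D; rewrite -D.
  apply: near_eq_derive; apply: (near_eq_on _ oU dp) => q Uq.
  exact: deriveEjacobian (dphi q Uq).
have [_ D0] := is_derive_mulmx (dXw e) (dP e).
have D00 : 'D_e (fun q => vf_in c X q *m P q) p = 0.
  have <- : 'D_e (cst (0 : 'rV[R]_m)) p = 0 by rewrite derive_cst.
  apply: near_eq_derive; apply: (near_eq_on _ oU dp) => q Uq.
  exact: vf_expr_jacobian.
by rewrite E1 E2 E3 E4 addrC -D0 D00.
Qed.

(** In charts the pullback is a product [P q *m w q]. The factor [w] depends on [q] only through
    [f], so its derivative along [X] vanishes; [lie_jacobian] deals with the Jacobian [P]. *)
Lemma lie_covector c p : atlas c -> cod c p ->
  'D_(vf_in c X p) (covector_in c (covector_pullback a)) p +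
  'J (vf_in c X) p *m covector_in c (covector_pullback a) p = 0.
Proof.
move=> ac cp; pose d := chart_at (f (bwd c p)).
have ad : atlas d by exact: chart_at_atlas.
have dp : expr_dom c d p by split=> //; exact: chart_at_dom.
have oU := @open_expr_dom c d.
have sphi := smooth_expr ac ad.
set P := fun q => 'J (chart_expr c d) q; set v := vf_in c X p.
pose w := covector_in d a \o chart_expr c d.
have dphi : differentiable (chart_expr c d) p.
  exact: smooth_on_differentiable oU sphi dp.
have dP : derivable P p v.
  exact: Ck_on_derivable (Ck_on_jacobian oU (sphi 2%N)) dp.
have ddp : cod d (chart_expr c d p) by case: dp => _ ?; exact: fwd_cod.
have da : differentiable (covector_in d a) (chart_expr c d p).
  exact: smooth_on_differentiable (@cod_open _ _ _ d) (sa ad) ddp.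
have dw : 'D_v w p = 0.
  by rewrite derive_comp // deriveEjacobian // vf_expr_jacobian // derive0.
have dew : derivable w p v by apply: diff_derivable; exact: differentiable_comp.
have E : {near p, covector_in c (covector_pullback a) =1 (fun q => P q *m w q)}.
  by apply: (near_eq_on _ oU dp) => q Uq; rewrite (covector_in_pullback _ ac ad Uq).
have [_ D] := is_derive_mulmx dP dew.
rewrite (near_eq_derive _ E) D dw mulmx0 addr0 (covector_in_pullback _ ac ad dp).
by rewrite mulmxA -mulmxDl lie_jacobian // mul0mx.
Qed.

(** By the Leibniz rule the Lie derivative of [s *m s^T] is a sum of two products, each containing
    the Lie derivative of [s], which is 0. *)
Lemma lie_sub_square (g : M -> 'M[R]_n) c p : smooth_tensor g ->
  atlas c -> cod c p ->
  let s := covector_pullback a in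
  lie_derivative_in c X (fun x => g x - s x *m (s x)^T) p =
  lie_derivative_in c X g p.
Proof.
move=> sg ac cp s; rewrite /lie_derivative_in.
have -> : tensor_in c (fun x => g x - s x *m (s x)^T) =
    (fun q => tensor_in c g q - covector_in c s q *m (covector_in c s q)^T).
  by apply/funext => q; exact: tensor_in_sub_square.
set v := vf_in c X p; set S := covector_in c s.
have ss : smooth_covector s by exact: smooth_covector_pullback.
have dS : derivable S p v by exact: Ck_on_derivable (ss c ac 1%N) cp.
have dST : derivable (fun q => (S q)^T) p v.
  exact: Ck_on_derivable (Ck_on_trmx (@cod_open _ _ _ c) (ss c ac 1%N)) cp.
have DT : 'D_v (fun q => (S q)^T) p = ('D_v S p)^T.
  apply/matrixP => i j; rewrite (derive_entry i j dST) mxE (derive_entry j i dS).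
  have -> // : (fun q => (S q)^T i j) = (fun q => S q j i).
  by apply/funext => q; rewrite mxE.
have dg : derivable (tensor_in c g) p v by exact: smooth_tensor_derivable.
have [dSS DSS] := is_derive_mulmx dS dST.
rewrite (deriveB dg dSS) DSS DT.
have lS : 'D_v S p + 'J (vf_in c X) p *m S p = 0 by exact: lie_covector.
have lST : ('D_v S p)^T + (S p)^T *m ('J (vf_in c X) p)^T = 0.
  by rewrite -trmx_mul -linearD lS linear0.
set J := 'J (vf_in c X) p in lS lST *.
set T := tensor_in c g p; set DgT := 'D_v _ p.
rewrite mulmxBr mulmxBl.
have -> : 'D_v S p = - (J *m S p) by apply/eqP; rewrite -addr_eq0 lS.
have -> : (- (J *m S p))^T = - ((S p)^T *m J^T) by rewrite linearN /= trmx_mul.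
rewrite mulNmx mulmxN !mulmxA.
set A := J *m T; set B := _ *m _ *m (S p)^T; set C := T *m J^T.
set E := S p *m _ *m _; move: DgT A B C E => D A B C E.
by apply/matrixP => i j; rewrite !mxE; ring.
Qed.

End VerticalLie.

End Pullback.

(** * Bump functions *)

Section Bumps.
Variables (R : realType) (n : nat) (M : manifold R n).

Lemma compact_closed_ball (p : 'rV[R]_n) (r : R) : compact [set q | `|p - q| <= r].
Proof.
apply: bounded_closed_compact; last exact: closed_closed_ball_.
exists (r + `|p|); split; first exact: num_real.
move=> x xr q /= qr; apply: le_trans _ (ltW xr).
by rewrite -[q](subrK p) (le_trans (ler_normD _ _)) // lerD2r distrC.
Qed.

Lemma smooth_bump (x0 : M) (D : set M) : open D -> D x0 ->
  exists (u : M -> R) (C : set M),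
    [/\ smooth_fun u, forall x, 0 <= u x, 0 < u x0, compact C &
      C `<=` D `&` dom (chart_at x0) /\ forall x, u x != 0 -> C x].
Proof.
move=> oD Dx0; set c := chart_at x0.
have ac : atlas c by exact: chart_at_atlas.
have cx0 : dom c x0 by exact: chart_at_dom.
have /nbhs_ballP[r /= r0 rU] := chart_nbhs oD cx0 Dx0.
pose d := r / 2; have d0 : 0 < d by rewrite divr_gt0.
have dr : d < r by rewrite /d ltr_pdivrMr // ltr_pMr // ltr1n.
(* The norm on rows is the maximum norm, which is not smooth, so [rho] uses the Euclidean distance;
   the Euclidean ball lies in the ball [K] of the maximum norm. *)
pose rho (p : 'rV[R]_n) := d ^+ 2 +
  - 1 * \sum_j (p 0 j - c x0 0 j) * (p 0 j - c x0 0 j).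
pose K := [set p | `|c x0 - p| <= d].
have KU p : K p -> cod c p /\ D (bwd c p).
  move=> Kp; apply: rU; rewrite -ball_normE /=.
  exact: le_lt_trans Kp dr.
have rhoK p : 0 < rho p -> K p.
  rewrite /rho mulN1r subr_gt0 => lt; rewrite /K /=.
  rewrite [leLHS]/Num.Def.normr/= mx_normrE; apply: bigmax_le => [|[i j] _] /=.
    exact: ltW.
  rewrite !mxE ord1 distrC -(ler_pXn2r (n := 2)) ?nnegrE // ?ltW //.
  rewrite real_normK ?num_real //; apply: le_lt_trans _ lt.
  rewrite (bigD1 j) //= expr2 lerDl; apply: sumr_ge0 => k _.
  by rewrite -expr2 sqr_ge0.
pose C := bwd c @` K.
have cC : compact C.
  apply: continuous_compact; last exact: compact_closed_ball.
  apply: continuous_in_subspaceT => p /set_mem /KU[cp _].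
  exact: bwd_continuous.
have clC : closed C by apply: compact_closed cC; exact: carrier_hausdorff.
pose u x := if `[< dom c x >] then flat 0 (rho (c x)) else 0.
have uC x : u x != 0 -> C x.
  rewrite /u; case: asboolP => [dx|_]; last by rewrite eqxx.
  move=> ux; exists (c x); last by rewrite fwdK.
  apply: rhoK; rewrite ltNge; apply: contra ux => le.
  by rewrite flat_eq0.
exists u, C; split=> //.
- move=> e ae; apply: smooth_on_local => p ep.
  have [dp|dp] := pselect (dom c (bwd e p)).
    exists (cod e `&` bwd e @^-1` dom c), (flat 0 \o (rho \o (c \o bwd e))).
    have oU := @open_chart_preimage R M n e _ (@dom_open _ _ _ c).
    split=> //.
      move=> k; apply: Ck_on_flat => //.
      apply: (@Ck_on_comp_scalar R n n k _ setT (c \o bwd e) rho) => //.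
      + exact: openT.
      + exact: transition_smooth.
      apply: Ck_onD; [exact: openT|exact: Ck_on_cst|].
      apply: Ck_onM; [exact: openT|exact: Ck_on_cst|].
      apply: Ck_on_sum => [|j _]; first exact: openT.
      have Cj : Ck_on k setT (fun p : 'rV[R]_n => p 0 j - c x0 0 j).
        apply: Ck_onD; [exact: openT| |exact: Ck_on_cst].
        exact: ((Ck_on_mxP k _ openT).1 (Ck_on_id k setT) 0 j).
      by apply: Ck_onM => //; exact: openT.
    by move=> q [_ dq]; rewrite /= /u; case: asboolP.
  (* Outside the chart, [u] vanishes on the complement of [C], which is open because a compact set
     in a Hausdorff space is closed. *)
  exists (cod e `&` bwd e @^-1` (~` C)), (fun=> 0); split.
  - exact/open_chart_preimage/closed_openC.
  - split=> // -[q Kq E]; apply: dp; rewrite -E.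
    by apply: bwd_dom; case: (KU _ Kq).
  - by move=> k; exact: Ck_on_cst.
  - by move=> q [_ nC]; apply/esym/eqP; apply: contraT => /uC.
- by move=> x; rewrite /u; case: asboolP => // _; exact: flat_ge0.
- rewrite /u; case: asboolP => // _; apply: flat_gt0.
  rewrite /rho big1 => [|j _]; last by rewrite subrr mul0r.
  by rewrite mulr0 addr0 exprn_gt0.
- by split=> // _ [p Kp <-]; have [cp Dp] := KU _ Kp; split=> //; exact: bwd_dom.
Qed.

(** [to_chart c x *m l] is the covector with constant components [l] in the chart [c]; the cutoff
    [w] extends it by 0 beyond [dom c]. *)
Lemma smooth_chart_covector (c : chart R M n) (w : M -> R) (C : set M) (l : 'cV[R]_n) :
  atlas c -> smooth_fun w -> closed C -> C `<=` dom c ->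
  (forall x, w x != 0 -> C x) ->
  smooth_covector (fun x => w x *: (to_chart c x *m l)).
Proof.
move=> ac sw clC Cc wC e ae; apply: smooth_on_local => p ep.
have [dp|dp] := pselect (dom c (bwd e p)).
  have oU := @open_chart_preimage R M n e _ (@dom_open _ _ _ c).
  exists (cod e `&` bwd e @^-1` dom c),
    (fun q => (w \o bwd e) q *: ('J (c \o bwd e) q *m l)); split=> //.
    move=> k; apply: (Ck_onZ oU).
      exact: (smooth_onW (@subIsetl _ _ _) (sw e ae)).
    apply: (Ck_on_mulmx oU _ (Ck_on_cst _ _ l)).
    exact: Ck_on_jacobian oU (transition_smooth ae ac k.+1).
  move=> q [cq dq].
  have J := eq_ind _ (fun z => 'J (c \o bwd e) z = _)
    (transition_jacobian ae ac (bwd_dom cq) dq) _ (bwdK cq).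
  transitivity (w (bwd e q) *: (of_chart e (bwd e q) *m to_chart c (bwd e q) *m l)).
    by congr (_ *: (_ *m _)); exact: J.
  by rewrite /covector_in -mulmxA scalemxAr.
exists (cod e `&` bwd e @^-1` (~` C)), (fun=> 0); split.
- exact/open_chart_preimage/closed_openC.
- by split=> // /Cc.
- by move=> k; exact: Ck_on_cst.
- move=> q [_ nC]; rewrite /covector_in.
  have -> : w (bwd e q) = 0 by apply/eqP; apply: contraT => /wC.
  by rewrite scale0r mulmx0.
Qed.

Lemma countable_subcover (x0 : M) (O : M -> set M) :
  (forall x, open (O x) /\ O x x) ->
  exists b : nat -> M, forall x, exists k, O (b k) x.
Proof.
move=> oO; have [A cA [oA bA]] := @carrier_second_countable R n M.
have /countable_injP[f finj] := cA.
(* Lindelof argument: for each basic open set contained in some [O y], one such [y] is kept. The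
   default [x0] fills the remaining indices. *)
pose b k := xget x0 [set y | exists U, [/\ A U, f U = k & U `<=` O y]].
exists b => x; have [oOx Oxx] := oO x.
have [U [AU Ux UO]] := bA x (O x) (open_nbhs_nbhs (conj oOx Oxx)).
exists (f U); rewrite /b; case: xgetP => [y _ [U' [AU' fU UO']]|/(_ x)].
  apply: UO'; suff -> : U' = U by [].
  by apply: finj => //; rewrite inE.
by case; exists U.
Qed.

End Bumps.

(** * Causal covector fields on a spacetime *)

Lemma bilin_congr (R : realType) n (G P Q : 'M[R]_n) v : P *m Q = 1%:M ->
  bilin (Q *m G *m Q^T) (v *m P) (v *m P) = bilin G v v.
Proof.
move=> PQ; rewrite /bilin trmx_mul !mulmxA -(mulmxA v P Q) PQ mulmx1.
by rewrite -!mulmxA (mulmxA Q^T) -trmx_mul PQ trmx1 mul1mx.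
Qed.

Section SpacetimeCovectors.
Variables (R : realType) (m : nat) (B : spacetime R m).
Notation h := (@st_metric R m B).

Lemma future_nonspacelike b v : st_future b v -> nonspacelike (h b) v.
Proof.
have [st _] := @st_time_oriented R m B; have [w Cw ->] := st b.
by case=> A [_ AC _] /AC.
Qed.

Lemma bilin_tensor_in (c : chart R B m) b v : atlas c -> dom c b ->
  bilin (tensor_in c h (c b)) (v *m to_chart c b) (v *m to_chart c b) =
  bilin (h b) v v.
Proof.
move=> ac cb; rewrite /tensor_in (fwdK cb); exact: bilin_congr (to_of_chart ac cb).
Qed.

Lemma to_chart_neq0 (c : chart R B m) b (v : 'rV[R]_m) : atlas c -> dom c b ->
  v != 0 -> v *m to_chart c b != 0.
Proof.
move=> ac cb v0; apply/eqP => E; move/eqP: v0; apply.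
have := congr1 (fun w => w *m of_chart c b) E.
by rewrite /= mul0mx -mulmxA (to_of_chart ac cb) mulmx1.
Qed.

(** A covector good at [b0], kept constant in the chart, stays good nearby by [lorentz_pos_open];
    the continuous future field [X] controls its sign. *)
Lemma local_causal_coval (b0 : B) :
  exists (l : 'cV[R]_m) (W : set B),
    [/\ open W, W b0, W `<=` dom (chart_at b0) & forall b, W b ->
      causal_coval (h b) (to_chart (chart_at b0) b *m l) /\
      exists2 u, st_future b u & 0 < coval u (to_chart (chart_at b0) b *m l)].
Proof.
set c := chart_at b0.
have ac : atlas c by exact: chart_at_atlas.
have cb0 : dom c b0 by exact: chart_at_dom.
pose H b := tensor_in c h (c b).
have H0 : H b0 = h b0.
  have E : of_chart c b0 = 1%:M by exact: transition_jacobian_id.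
  by rewrite /H /tensor_in (fwdK cb0) E mul1mx trmx1 mulmx1.
have cH : {for b0, continuous H}.
  exact: continuous_comp (fwd_continuous cb0)
    (Ck_on_continuous (st_smooth ac 0%N) (fwd_cod cb0)).
have [a [l l0 lb]] :=
  lorentz_bound (st_symmetric b0) (st_index b0) (st_nondegenerate b0).
have [d d0 dP] := lorentz_pos_open l0 lb.
have aC b : dom c b -> `|H b - h b0| < d -> causal_coval (h b) (to_chart c b *m a).
  move=> cb Hb v /nonspacelikeE[v0 hv].
  have := dP _ Hb (v *m to_chart c b) (to_chart_neq0 ac cb v0).
  by rewrite bilin_tensor_in // /coval mulmxA; exact.
have nH : \forall b \near b0, `|H b - h b0| < d.
  move/cvgrPdist_lt : cH => /(_ d d0); rewrite H0.
  by apply: filterS => b; rewrite distrC.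
have [_ toX] := @st_time_oriented R m B.
have [U [X [oU Ub0 cX fX]]] := toX b0.
pose f b := coval (X b *m to_chart c b) a.
have cf : {for b0, continuous f}.
  exact: continuous_comp (cX c ac b0 Ub0 cb0) (@coval_continuous _ _ a _).
have fE b : f b = coval (X b) (to_chart c b *m a) by rewrite /f /coval mulmxA.
have f0 : f b0 != 0.
  rewrite fE; apply: aC; rewrite ?H0 ?subrr ?normr0 //.
  exact/future_nonspacelike/fX.
(* So far the covector is good only up to sign; [e] makes it positive on [X] at [b0], hence
   nearby. *)
pose e := Num.sg (f b0).
have e0 : 0 < e * f b0 by rewrite -normrEsg normr_gt0.
have en0 : e != 0 by rewrite sgr_eq0.
have cef : {for b0, continuous (fun b => e * f b)}.
  exact: continuousM (@cst_continuous _ _ e b0) cf.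
have nf : \forall b \near b0, 0 < e * f b.
  exact: cvgr_gt cef _ e0.
have nU : \forall b \near b0, U b by exact: open_nbhs_nbhs.
have nc : \forall b \near b0, dom c b.
  by apply: open_nbhs_nbhs; split=> //; exact: dom_open.
have : \forall b \near b0, (`|H b - h b0| < d /\ 0 < e * f b) /\ (U b /\ dom c b).
  exact: filterI (filterI nH nf) (filterI nU nc).
rewrite /prop_near1 nbhsE; case=> W [oW Wb0] WP.
exists (e *: a), W; split=> //.
  by move=> b /WP[_ []].
move=> b /WP[[Hb fb] [Ub cb]].
have E v : coval v (to_chart c b *m (e *: a)) = e * coval v (to_chart c b *m a).
  by rewrite /coval -scalemxAr -scalemxAr mxE.
split.
  by move=> v Cv; rewrite E; apply: mulf_neq0 => //; exact: aC.
exists (X b); first exact: fX.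
by rewrite E -fE.
Qed.

Lemma causal_coval_sign b (a a' : 'cV[R]_m) u u' v :
  causal_coval (h b) a -> causal_coval (h b) a' ->
  st_future b u -> 0 < coval u a -> st_future b u' -> 0 < coval u' a' ->
  nonspacelike (h b) v -> 0 < coval v a -> 0 < coval v a'.
Proof.
have [st _] := @st_time_oriented R m B; have [w Cw E] := st b.
rewrite E => aC aC' Fu ua Fu' ua'.
exact: (future_coval_sign (st_symmetric b) aC aC' Fu ua Fu' ua').
Qed.

(** The last clause excludes cancellation: on a causal vector the [a k] have a common weak sign and
    are not all zero, so every combination with positive coefficients is nonzero there. *)
Lemma causal_covector_family :
  exists (a : nat -> B -> 'cV[R]_m) (C : nat -> set B),
    [/\ forall k, smooth_covector (a k),
        forall k, compact (C k) /\ forall b, ~ C k b -> a k b = 0,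
        forall b, exists k0 D, [/\ open D, D b &
          forall b' k, D b' -> (k0 < k)%N -> a k b' = 0] &
        forall b v, nonspacelike (h b) v ->
          (exists k, coval v (a k b) != 0) /\
          ((forall k, 0 <= coval v (a k b)) \/ (forall k, coval v (a k b) <= 0))].
Proof.
have [[x0 _] _] := st_connected B.
have [l lW'] := choice local_causal_coval; have [W lW] := choice lW'.
have uC' : forall b, exists (u : B -> R) (C : set B),
    [/\ smooth_fun u, forall x, 0 <= u x, 0 < u b, compact C &
      C `<=` W b `&` dom (chart_at b) /\ forall x, u x != 0 -> C x].
  by move=> b; have [oW Ob _ _] := lW b; exact: smooth_bump.
have [u uC''] := choice uC'; have [C uC] := choice uC''.
pose s b := u b b / 2.
have s0 b : 0 < s b by have [_ _ ub _ _] := uC b; rewrite divr_gt0.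
have cu b : continuous (u b).
  by have [su _ _ _ _] := uC b; exact: smooth_fun_continuous.
have oS b : open [set x | s b < u b x].
  have -> : [set x | s b < u b x] = u b @^-1` [set y | s b < y] by [].
  by apply: open_comp; [move=> x _; exact: cu|exact: open_gt].
have Sb b : s b < u b b.
  have [_ _ ub _ _] := uC b.
  by rewrite /s ltr_pdivrMr // ltr_pMr // ltr1n.
have [bb cover] := countable_subcover x0 (fun b => conj (oS b) (Sb b)).
(* The j-th factor vanishes exactly where [u (bb j)] is at least [s (bb j)]. Hence on the open set
   where [u (bb k0)] exceeds [s (bb k0)], all [w k] with [k > k0] are 0. *)
pose w k x := u (bb k) x * \prod_(j < k) flat 0 (s (bb j) + -1 * u (bb j) x).
have w_ge0 k x : 0 <= w k x.
  have [_ u0 _ _ _] := uC (bb k); apply: mulr_ge0 => //.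
  by apply: prodr_ge0 => j _; exact: flat_ge0.
have w_eq0 k j x : (j < k)%N -> s (bb j) < u (bb j) x -> w k x = 0.
  move=> jk sj; rewrite /w (bigD1 (Ordinal jk)) //= flat_eq0 ?mul0r ?mulr0 //.
  by rewrite mulN1r subr_le0 ltW.
have w_pos x : exists k, 0 < w k x.
  (* The inequality is weak so that minimality of [k] gives strict inequalities for all [j < k],
     which makes the factors positive. *)
  have ex : exists k, s (bb k) <= u (bb k) x.
    by have [k /= lt] := cover x; exists k; exact: ltW.
  exists (ex_minn ex); case: ex_minnP => k sk kmin.
  apply: mulr_gt0; first exact: lt_le_trans sk.
  apply: prodr_gt0 => j _; apply: flat_gt0; rewrite mulN1r subr_gt0 ltNge.
  by apply/negP => /kmin; rewrite leqNgt ltn_ord.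
have wC k x : w k x != 0 -> C (bb k) x.
  have [_ _ _ _ [_ supp]] := uC (bb k); move=> wx; apply: supp.
  by apply: contraNneq wx => ux; rewrite /w ux mul0r.
have sw k : smooth_fun (w k).
  have [su _ _ _ _] := uC (bb k); apply: smooth_funM => //.
  apply: smooth_fun_prod => j; apply: smooth_fun_flat.
  apply: smooth_funD; first exact: smooth_fun_cst.
  apply: smooth_funM; first exact: smooth_fun_cst.
  by have [] := uC (bb j).
pose al k x := to_chart (chart_at (bb k)) x *m l (bb k).
exists (fun k x => w k x *: al k x), (fun k => C (bb k)); split.
- move=> k; have [_ _ _ cC [CW _]] := uC (bb k).
  apply: (@smooth_chart_covector _ _ _ _ _ (C (bb k))) => //.
  + exact: chart_at_atlas.
  + by apply: compact_closed cC; exact: carrier_hausdorff.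
  + by move=> x /CW[].
  + exact: wC.
- move=> k; split; first by have [] := uC (bb k).
  move=> b nC; have -> : w k b = 0 by apply/eqP; apply: contraT => /wC.
  by rewrite scale0r.
- move=> b; have [k0 sk0] := cover b.
  exists k0, [set x | s (bb k0) < u (bb k0) x]; split=> // b' k sb' k0k.
  by rewrite (w_eq0 k k0 b') // scale0r.
move=> b v Cv.
have E k : coval v (w k b *: al k b) = w k b * coval v (al k b).
  by rewrite /coval -scalemxAr mxE.
have good k : w k b != 0 -> causal_coval (h b) (al k b) /\
    exists2 u, st_future b u & 0 < coval u (al k b).
  move=> /wC Cb; have [_ _ _ _ [CW _]] := uC (bb k).
  by have [_ _ _ WP] := lW (bb k); apply: WP; have [] := CW _ Cb.
have [k wk] := w_pos b; have [aC [t Ft ta]] := good k (lt0r_neq0 wk).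
split; first by exists k; rewrite E; apply: mulf_neq0; [exact: lt0r_neq0|exact: aC].
have same v' : nonspacelike (h b) v' -> 0 < coval v' (al k b) ->
    forall j, 0 <= w j b * coval v' (al j b).
  move=> Cv' va j; have [->|wj] := eqVneq (w j b) 0; first by rewrite mul0r.
  have [aC' [t' Ft' ta']] := good j wj.
  exact: mulr_ge0 (w_ge0 _ _) (ltW (causal_coval_sign aC aC' Ft ta Ft' ta' Cv' va)).
have := aC v Cv; rewrite neq_lt => /orP[va|va]; [right|left] => j; rewrite E.
  have := same (- v) (nonspacelikeN Cv); rewrite covalN oppr_gt0 => /(_ va j).
  by rewrite covalN mulrN oppr_ge0.
exact: same.
Qed.

(** The bound [N b] is chosen point by point. Sums up to different valid bounds differ by zero
    terms, so on [D b] the field is one fixed finite sum. *)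
Lemma locally_finite_sum (a : nat -> B -> 'cV[R]_m) (e : nat -> R) :
  (forall k, smooth_covector (a k)) ->
  (forall b, exists k0 D, [/\ open D, D b &
     forall b' k, D b' -> (k0 < k)%N -> a k b' = 0]) ->
  exists2 w : B -> 'cV[R]_m, smooth_covector w &
    forall b, exists2 N : nat, w b = \sum_(k < N) e k *: a k b &
      forall k, (N <= k)%N -> a k b = 0.
Proof.
move=> sa lf; have [N ND'] := choice lf; have [D ND] := choice ND'.
have stable b b' : D b b' -> \sum_(k < (N b').+1) e k *: a k b' =
    \sum_(k < (N b).+1) e k *: a k b'.
  have le n p : (n <= p)%N -> (forall k, (n < k)%N -> a k b' = 0) ->
      \sum_(k < n.+1) e k *: a k b' = \sum_(k < p.+1) e k *: a k b'.
    move=> np z; rewrite (big_ord_widen p.+1 (fun k => e k *: a k b')) // big_mkcond /=.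
    apply: eq_bigr => k _; case: ifPn => //; rewrite -leqNgt => nk.
    by rewrite z // scaler0.
  move=> Db; have [_ Db' zb'] := ND b'; have [_ _ zb] := ND b.
  have [nn|nn] := leqP (N b) (N b').
    by rewrite -(le _ _ nn) // => k; exact: zb.
  by rewrite (le _ _ (ltnW nn)) // => k; exact: zb'.
exists (fun b => \sum_(k < (N b).+1) e k *: a k b).
  apply: smooth_covector_local => b; have [oD Db _] := ND b.
  exists (D b), (fun b' => \sum_(k < (N b).+1) e k *: a k b'); split=> //.
    apply: smooth_covector_sum => k; apply: smooth_covectorZ => //.
    exact: smooth_fun_cst.
  by move=> b' /stable.
move=> b; exists (N b).+1 => // k Nk.
by have [_ Db z] := ND b; exact: z.
Qed.

End SpacetimeCovectors.

(** * Smallness in the Whitney topology *)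

(** The filter [F] expresses that an index set is large enough, that is, contains some finite set.
    Local finiteness gives the claim near each point for large [J], and compactness makes it uniform
    on [S]. *)
Lemma finite_compact_meets (T : topologicalType) (I : Type) (D : I -> set T)
    (S : set T) : compact S ->
  (forall x, exists U, [/\ open U, U x & finite_set [set i | U `&` D i !=set0]]) ->
  finite_set [set i | S `&` D i !=set0].
Proof.
move=> /compact_near_coveringP cS lf.
pose F : set_system (set I) := [set A | exists J0, finite_set J0 /\
  forall J, J0 `<=` J -> A J].
have FF : Filter F.
  split.
  - by exists set0; split=> //; exact: finite_set0.
  - move=> A A' [J [fJ JA]] [J' [fJ' JA']]; exists (J `|` J').
    rewrite finite_setU; split=> // L sub; split.
      by apply: JA => i Ji; apply: sub; left.
    by apply: JA' => i Ji; apply: sub; right.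
  - by move=> A A' AA' [J [fJ JA]]; exists J; split=> // L /JA/AA'.
have [|J [fJ JP]] := cS _ F (fun J x => forall i, D i x -> J i) FF.
  move=> x Sx; have [U [oU Ux fU]] := lf x.
  exists (U, [set J | [set i | U `&` D i !=set0] `<=` J]).
    split=> /=; first exact: open_nbhs_nbhs.
    by exists [set i | U `&` D i !=set0]; split.
  by move=> [y J] /= [Uy sub] i Di; apply: sub; exists y.
apply: (sub_finite_set _ fJ) => i [x [Sx Dx]].
exact: (JP J (@subset_refl _ J) x Sx i Dx).
Qed.

Lemma finite_common_scale (R : realType) (I : Type) (J : set I) (Q : I -> R -> Prop) :
  finite_set J ->
  (forall i, J i -> exists2 d, 0 < d & forall e, 0 < e <= d -> Q i e) ->
  exists2 d, 0 < d & forall i, J i -> forall e, 0 < e <= d -> Q i e.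
Proof.
move=> fJ QJ; have /countable_injP[f finj] := finite_set_countable fJ.
have /finite_seqP[s sE] : finite_set (f @` J) by exact: finite_image.
suff [d d0 dP] : exists2 d, 0 < d & forall i, J i -> f i \in s ->
    forall e, 0 < e <= d -> Q i e.
  exists d => // i Ji; apply: dP => //.
  have : (f @` J) (f i) by exists i.
  by rewrite sE.
elim: s {sE} => [|k s [d d0 IH]]; first by exists 1.
have [[i [Ji fi]]|no] := pselect (exists i, J i /\ f i = k); last first.
  exists d => // i Ji; rewrite inE => /orP[/eqP fi|]; last exact: IH.
  by case: no; exists i.
have [d' d'0 d'P] := QJ i Ji.
exists (Num.min d d'); first by rewrite lt_min d0.
move=> j Jj; rewrite inE => /orP[/eqP fj|js] e;
    rewrite le_min => /andP[e0 /andP[ed ed']].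
  have -> : j = i by apply: finj; rewrite ?inE // fi fj.
  by apply: d'P; rewrite e0.
by apply: (IH j) => //; rewrite e0.
Qed.

(** The minimum with 1 ensures [|s| <= 1], so that the square is bounded by [|s|] itself; the factor
    1/2 makes the bound strict. *)
Lemma square_norm_lt (R : realType) n (s : 'cV[R]_n) (e : R) : 0 < e ->
  `|s| <= Num.min 1 e / 2 -> `|s *m s^T| < e.
Proof.
move=> e0 se; have [m1 me] : Num.min 1 e <= 1 /\ Num.min 1 e <= e.
  by split; rewrite ge_min lexx ?orbT.
have m0 : 0 < Num.min 1 e by rewrite lt_min ltr01.
apply: (@le_lt_trans _ _ (`|s| * `|s|)).
  rewrite [leLHS]/Num.Def.normr/= mx_normrE; apply: bigmax_le => [|[i j] _] /=.
    exact: mulr_ge0.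
  by rewrite mxE big_ord1 [X in _ * X]mxE normrM ler_pM // mx_entry_le.
apply: (@le_lt_trans _ _ (1 * (Num.min 1 e / 2))); last by rewrite mul1r; lra.
by apply: ler_pM => //; lra.
Qed.

Section WhitneySmallness.
Variables (R : realType) (n m : nat) (M : manifold R n) (N : manifold R m).
Variables (f : M -> N) (I : Type) (c : I -> chart R M n) (K : I -> set M).
Hypotheses (sf : smooth_map f) (pf : proper_map f).
Hypothesis cK : forall i, [/\ atlas (c i), compact (K i) & K i `<=` dom (c i)].
Hypothesis lf : forall x, exists U : set M, [/\ open U, U x &
  finite_set [set i | U `&` dom (c i) !=set0]].

Lemma small_pullback (a : N -> 'cV[R]_m) (C : set N) (eta : I -> R) :
  smooth_covector a -> compact C -> (forall y, ~ C y -> a y = 0) ->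
  (forall i, 0 < eta i) ->
  exists2 e, 0 < e & forall i x, K i x ->
    e * `|covector_in (c i) (covector_pullback f a) (c i x)| <= eta i.
Proof.
move=> sa cC aC eta0; pose s i x := covector_in (c i) (covector_pullback f a) (c i x).
have fJ := finite_compact_meets (pf cC) lf.
(* The condition is required for all scales up to a threshold, so that the finitely many thresholds
   can be replaced by their minimum. *)
have [|d d0 dP] := @finite_common_scale R I _
    (fun i e => forall x, K i x -> e * `|s i x| <= eta i) fJ.
  move=> i _; have [ac cKi Kd] := cK i.
  have [[x0 Kx0]|K0] := pselect (K i !=set0); last first.
    by exists 1 => // e _ x Kx; case: K0; exists x.
  have cs : {within K i, continuous (fun x => `|s i x|)}.
    apply: continuous_in_subspaceT => x /set_mem Kx; apply: cvg_norm.
    exact: covector_in_continuous ac (Kd _ Kx) (smooth_covector_pullback sf sa).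
  have [x1 _ xmax] := compact_EVT_max (ex_intro _ x0 Kx0) cKi cs.
  have p0 : 0 < `|s i x1| + 1 by rewrite ltr_wpDl.
  exists (eta i / (`|s i x1| + 1)); first exact: divr_gt0.
  move=> e /andP[e0 le] x Kx.
  apply: (@le_trans _ _ (eta i / (`|s i x1| + 1) * (`|s i x1| + 1))).
    apply: ler_pM => //; first exact: ltW.
    by apply: le_trans (xmax x (mem_set Kx)) _; rewrite lerDl.
  by rewrite divfK // gt_eqF.
exists d => // i x Kx; have [ac _ Kd] := cK i.
(* If [f x] lies outside [C], the pullback vanishes at [x]; this settles all charts not in the
   finite set. *)
have [Ji|nJ] := pselect (C (f x)).
  by apply: dP => //; [exists x; split=> //; exact: Kd|rewrite d0 lexx].
suff -> : covector_in (c i) (covector_pullback f a) (c i x) = 0.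
  by rewrite normr0 mulr0 ltW.
by rewrite /covector_in (fwdK (Kd _ Kx)) /covector_pullback aC // !mulmx0.
Qed.

(** The number [p] of terms varies with [x], so the bounds on the terms have to be summable:
    geometric shares keep every partial sum below [eta i]. *)
Lemma small_pullback_sum (a : nat -> N -> 'cV[R]_m) (C : nat -> set N) (eta : I -> R) :
  (forall k, smooth_covector (a k)) ->
  (forall k, compact (C k) /\ forall y, ~ C k y -> a k y = 0) ->
  (forall i, 0 < eta i) ->
  exists2 e : nat -> R, forall k, 0 < e k &
    forall (w : N -> 'cV[R]_m) i x, K i x ->
      (exists p : nat, w (f x) = \sum_(k < p) e k *: a k (f x)) ->
      `|covector_in (c i) (covector_pullback f w) (c i x)| <= eta i.
Proof.
move=> sa aC eta0.
have small k : exists e, 0 < e /\ forall i x, K i x ->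
    e * `|covector_in (c i) (covector_pullback f (a k)) (c i x)| <= eta i / 2 ^+ k.+1.
  have [cC a0] := aC k.
  have [|e e0 eP] := @small_pullback (a k) (C k)
    (fun i => eta i / 2 ^+ k.+1) (sa k) cC a0.
    by move=> i; rewrite divr_gt0 // exprn_gt0.
  by exists e.
have [e eP] := choice small; exists e => [k|w i x Kx [p wE]].
  by have [] := eP k.
have [ac _ Kd] := cK i.
have E (v : N -> 'cV[R]_m) : covector_in (c i) (covector_pullback f v) (c i x) =
    of_chart (c i) x *m tangent_map f x *m v (f x).
  by rewrite /covector_in (fwdK (Kd _ Kx)) /covector_pullback mulmxA.
rewrite E wE mulmx_sumr.
apply: le_trans (ler_norm_sum _ _ _) _.
apply: (@le_trans _ _ (\sum_(k < p) eta i / 2 ^+ k.+1)).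
  apply: ler_sum => k _; have [ek ekP] := eP k.
  have := ekP i x Kx; rewrite E; apply: le_trans.
  by rewrite -scalemxAr normrZ gtr0_norm.
have -> : \sum_(k < p) eta i / 2 ^+ k.+1 = eta i * (1 - 1 / 2 ^+ p).
  elim: p {wE} => [|p IH]; first by rewrite big_ord0 expr0 divr1 subrr mulr0.
  rewrite big_ord_recr /= IH exprS.
  have p0 : (2 : R) ^+ p != 0 by rewrite expf_neq0.
  by field; rewrite p0.
apply: ler_piMr; first exact: ltW.
by rewrite gerBl divr_ge0 // exprn_ge0.
Qed.

End WhitneySmallness.

(** * The perturbed transverse metric and its time orientation *)

Theorem proposition8p10 (R : realType) (n q m : nat) (M : manifold R n)
    (F : foliation M q) (g : M -> 'M[R]_n) (tau : M -> set 'rV[R]_n)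
    (B : spacetime R m) (pi : M -> B) :
  (3 <= n)%N -> (2 <= q)%N ->
  connected_manifold M ->
  transverse_lorentzian F g ->
  transverse_time_orientation F g tau ->
  simple_over F pi g tau ->
  proper_map pi ->
  (exists2 U : set (M -> 'M[R]_n), TL_C0_nbhd F g U &
     forall g', U g' -> forall tau', transverse_time_orientation F g' tau' ->
       transversely_causal F tau') ->
  transversely_stably_causal F g tau.
Proof.
move=> _ _ _ [sg symg lieg lorg] [tau1 tau2] [[[spi fpi] _] _ gE _ _] ppi.
move=> [_ [A [I [c [K [e [ci lf nbhdA]]]]] ->] causalU].
have bilin_g x v w : bilin (g x) v w =
    bilin (st_metric (pi x)) (v *m tangent_map pi x) (w *m tangent_map pi x).
  by rewrite gE /pullback /bilin trmx_mul !mulmxA.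
(* The vertical space is the kernel of [g x]. Since the differential of [pi] is onto and the metric
   of [B] is nondegenerate, this is the kernel of the differential. *)
have vertP x v : vertical F x v <-> v *m tangent_map pi x = 0.
  have [_ <-] := lorg x; split=> [Kv|v0 u]; last first.
    by rewrite bilin_g v0 bilin0l.
  have : Defs.kernel (st_metric (pi x)) (v *m tangent_map pi x).
    move=> u; have /row_fullP[T TE] := fpi x.
    by have := Kv (u *m T); rewrite bilin_g -mulmxA TE mulmx1.
  by rewrite st_nondegenerate.
have [a [C [sa aC aLF aS]]] := causal_covector_family B.
have ci' i : [/\ atlas (c i), compact (K i) & K i `<=` dom (c i)] by have [] := ci i.
(* The bound on [s] under which [square_norm_lt] gives the tolerance [e i] for [s *m s^T]. *)
pose eta i := Num.min 1 (e i) / 2.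
have eta0 i : 0 < eta i.
  by have [_ _ _ ei] := ci i; rewrite divr_gt0 // lt_min ltr01.
have [ek ek0 small] := small_pullback_sum spi ppi ci' lf sa aC eta0.
have [w sw wE] := locally_finite_sum ek sa aLF.
have w_causal b v : nonspacelike (st_metric b) v -> coval v (w b) != 0.
  move=> /aS[[k ak] sgn]; have [p -> pz] := wE b.
  have kp : (k < p)%N.
    rewrite ltnNge; apply: contra ak => /pz ->.
    by rewrite /coval mulmx0 mxE.
  have -> : coval v (\sum_(k < p) ek k *: a k b) = \sum_(k < p) ek k * coval v (a k b).
    rewrite /coval mulmx_sumr summxE; apply: eq_bigr => j _.
    by rewrite -scalemxAr mxE.
  have nz : ek k * coval v (a k b) != 0 by apply: mulf_neq0 => //; exact: lt0r_neq0.
  case: sgn => sgn; rewrite (bigD1 (Ordinal kp)) //=.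
    rewrite gt_eqF // ltr_pwDl ?sumr_ge0 // => [|j _].
      by rewrite lt_def nz mulr_ge0 // ltW.
    by rewrite mulr_ge0 // ltW.
  rewrite lt_eqF // ltr_nwDl ?sumr_le0 // => [|j _].
    by rewrite lt_neqAle nz mulr_ge0_le0 // ltW.
  by rewrite mulr_ge0_le0 // ltW.
pose s := covector_pullback pi w.
have ss : smooth_covector s by exact: smooth_covector_pullback.
have sE x v : coval v (s x) = coval (v *m tangent_map pi x) (w (pi x)).
  by rewrite /coval mulmxA.
have s_vert x v : vertical F x v -> coval v (s x) = 0.
  by move/vertP => v0; rewrite sE v0 coval0.
have s_causal x v : ~ vertical F x v -> bilin (g x) v v <= 0 -> coval v (s x) != 0.
  move=> nv gv; rewrite sE; apply: w_causal; apply/nonspacelikeE.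
  by split; [apply/eqP => /vertP|rewrite -bilin_g].
pose g' x := g x - s x *m (s x)^T.
have bilin_g' x v : bilin (g' x) v v = bilin (g x) v v - coval v (s x) ^+ 2.
  by rewrite bilin_sub_square expr2.
have TLg' : transverse_lorentzian F g'.
  split.
  - exact: smooth_tensor_sub_square.
  - by move=> x; rewrite linearB /= trmx_mul trmxK symg.
  - move=> X sX XV d ad p dp.
    have XV' x : X x *m tangent_map pi x = 0 by apply/vertP; exact: XV.
    by rewrite (lie_sub_square spi sX XV' sw sg ad dp); exact: lieg.
  - move=> x; have [ig kg] := lorg x.
    have [||i' k'] := @sub_square_index _ _ (g x) (s x) (symg x) ig.
    + by rewrite kg; exact: s_vert.
    + by rewrite kg; exact: s_causal.
    by split=> //; rewrite k'.
have gg' : wider F g g'.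
  move=> x v nv gv; rewrite bilin_g'.
  have : 0 < coval v (s x) ^+ 2.
    by rewrite lt_def sqr_ge0 sqrf_eq0 andbT s_causal.
  by move: gv; move: (coval _ _ ^+ 2) (bilin _ _ _) => y z; lra.
have sub x : causal_vectors (vertical F x) (g x) `<=`
    causal_vectors (vertical F x) (g' x).
  by move=> v [nv gv]; split=> //; exact/ltW/gg'.
have t0 x : exists v, tau x v.
  by have [U [X [_ Ux _ tX]]] := tau2 x; exists (X x); exact: tX.
have [v0 tv0] := choice t0.
(* The old wedge is connected and causal for [g'], so the component of any of its vectors contains
   all of it, and the local fields orienting [g] orient [g'] too. *)
pose tau' x := connected_component (causal_vectors (vertical F x) (g' x)) (v0 x).
have tt' x : tau x `<=` tau' x.
  have [v1 _ tE] := tau1 x => v tv.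
  have : connected_component (causal_vectors (vertical F x) (g x)) (v0 x) v.
    have := tv0 x; move: tv; rewrite tE => v1v v1v0.
    exact: connected_component_trans (connected_component_sym v1v0) v1v.
  by case=> D [D0 Dg cD] Dv; exists D => //; split=> //; exact: subset_trans (sub x).
have ttau' : transverse_time_orientation F g' tau'.
  split=> [x|x].
    exists (v0 x) => //; apply: sub; have [v1 _ tE] := tau1 x.
    by have := tv0 x; rewrite tE => -[D [_ Dg _] /Dg].
  have [U [X [oU Ux cX tX]]] := tau2 x; exists U, X; split=> // y Uy.
  exact/tt'/tX.
exists g', tau'; split=> //.
(* The hypothesis holds for every time orientation of [g'], in particular for [tau']; what is left
   is that [g'] meets the tolerances. *)
apply: causalU ttau'; split=> //; apply: nbhdA; have [sg' symg' _ _] := TLg'.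
split=> //; split=> // i x Kx.
have -> : tensor_in (c i) g' (c i x) - tensor_in (c i) g (c i x) =
    - (covector_in (c i) s (c i x) *m (covector_in (c i) s (c i x))^T).
  by rewrite tensor_in_sub_square addrC addKr.
rewrite normrN; apply: square_norm_lt; first by have [] := ci i.
by apply: small Kx _; have [p pE _] := wE (pi x); exists p.
Qed.
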